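(* For every integer $n\ge 1$, the $q$-binomial-Eulerian polynomial $\tilde A_n(t,q)$ satisfies $$\tilde{A}_n(t,q)=\sum_{\pi\in\mathrm{PRW}_{n+1}}t^{\mathrm{des}(\pi)}q^{\mathrm{ai}(\pi)}.$$
   Context: Let $\mathfrak S_n$ be the set of permutations $\pi=\pi_1\pi_2\cdots\pi_n$ of $[n]=\{1,\dots,n\}$. Define $\mathrm{des}(\pi)=|\{i\in[n-1]:\pi_i>\pi_{i+1}\}|$, $\mathrm{exc}(\pi)=|\{i\in[n-1]:\pi_i>i\}|$, and $\mathrm{maj}(\pi)=\sum_{i\in[n-1],\,\pi_i>\pi_{i+1}} i$. For $n\ge1$ let $$A_n(t,q)=\sum_{\pi\in\mathfrak S_n}t^{\mathrm{exc}(\pi)}q^{\mathrm{maj}(\pi)-\mathrm{exc}(\pi)},\qquad \tilde A_n(t,q)=1+t\sum_{m=1}^n{n\brack m}_qA_m(t,q),$$ where ${n\brack m}_q=\frac{(q;q)_n}{(q;q)_m(q;q)_{n-m}}$ is the $q$-binomial coefficient and $(q;q)_n=\prod_{i=1}^n(1-q^i)$. An admissible inversion of $\pi\in\mathfrak S_n$ is an inversion pair $(\pi_i,\pi_j)$ (that is, $i<j$ and $\pi_i>\pi_j$) satisfying at least one of: (i) $1<i$ and $\pi_{i-1}<\pi_i$; (ii) there is some $k$ with $i<k<j$ and $\pi_i<\pi_k$. Let $\mathrm{ai}(\pi)$ be the number of admissible inversions of $\pi$. $\mathrm{PRW}_n$ is the set of permutations $\pi\in\mathfrak S_n$ such that,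 if $\pi$ has an ascent (an index $i\in[n-1]$ with $\pi_i<\pi_{i+1}$), then the smallest such index $i$ has $\pi_i=1$. For example $\mathrm{PRW}_3=\{123,132,213,312,321\}$. *)

(* Defs.v *)
From mathcomp Require Import all_boot all_order all_algebra all_fingroup.
From mathcomp Require Import ring lra zify.

Set Implicit Arguments.
Unset Strict Implicit.
Unset Printing Implicit Defensive.

Import Order.TTheory GRing.Theory Num.Theory.
Local Open Scope ring_scope.

(* Permutations of [n] are elements of 'S_n, so positions and values live in
   'I_n = {0, ..., n-1}: the position i : 'I_n stands for the 1-based position
   i + 1 and the value p i for the letter p i + 1.  The shift is invisible in
   every comparison below; it matters only in maj (positions are summed) and in
   PRW (the letter 1 is the ordinal of value 0). *)

Definition descent n (p : 'S_n) (i : 'I_n) : bool :=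
  [exists j : 'I_n, (j == i.+1 :> nat) && (p j < p i)%N].

Definition ascent n (p : 'S_n) (i : 'I_n) : bool :=
  [exists j : 'I_n, (j == i.+1 :> nat) && (p i < p j)%N].

Definition des n (p : 'S_n) : nat := #|[set i : 'I_n | descent p i]|.

(* The last position is never an excedance, so i may range over all of [n]. *)
Definition exc n (p : 'S_n) : nat := #|[set i : 'I_n | (i < p i)%N]|.

Definition maj n (p : 'S_n) : nat := (\sum_(i < n | descent p i) i.+1)%N.

Definition inversion n (p : 'S_n) (i j : 'I_n) : bool :=
  (i < j)%N && (p j < p i)%N.

Definition admissible n (p : 'S_n) (i j : 'I_n) : bool :=
  inversion p i j &&
  ([exists k : 'I_n, (k.+1 == i :> nat) && (p k < p i)%N]
   || [exists k : 'I_n, [&& (i < k)%N, (k < j)%N & (p i < p k)%N]]).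

Definition ai n (p : 'S_n) : nat :=
  #|[set ij : 'I_n * 'I_n | admissible p ij.1 ij.2]|.

Definition first_ascent n (p : 'S_n) (i : 'I_n) : bool :=
  ascent p i && [forall j : 'I_n, (j < i)%N ==> ~~ ascent p j].

Definition PRW n : {set 'S_n} :=
  [set p : 'S_n | [forall i : 'I_n, first_ascent p i ==> (p i == 0 :> nat)%N]].

(* Polynomials in t and q are elements of {poly {poly int}}: the outer
   indeterminate is t, the inner one is q. *)

Definition qpoch (n : nat) : {poly int} := \prod_(1 <= i < n.+1) (1 - 'X^i).

(* The division is exact for m <= n: see qbinomE. *)
Definition qbinom (n m : nat) : {poly int} :=
  qpoch n %/ (qpoch m * qpoch (n - m)).

(* The subtraction of naturals does not truncate: see exc_le_maj. *)
Definition A (n : nat) : {poly {poly int}} :=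
  \sum_(p : 'S_n) 'X^(maj p - exc p) *: 'X^(exc p).

Definition tA (n : nat) : {poly {poly int}} :=
  1 + 'X * \sum_(1 <= m < n.+1) qbinom n m *: A m.

Lemma qpochS n : qpoch n.+1 = qpoch n * (1 - 'X^(n.+1)).
Proof. by rewrite /qpoch big_nat_recr. Qed.

Lemma lead_coef_qpoch n : lead_coef (qpoch n) \is a GRing.unit.
Proof.
rewrite /qpoch big_nat; elim/big_ind: _ => [|x y ux uy|i /andP[i_gt0 _]].
- by rewrite lead_coef1 unitr1.
- by rewrite lead_coefM unitrM ux.
by rewrite -opprB lead_coefN lead_coefXnsubC // unitrN unitr1.
Qed.

Lemma qpoch_dvd m k : exists g, qpoch (m + k) = g * (qpoch m * qpoch k).
Proof.
have [s] := ubnP (m + k)%N; elim: s m k => // s IHs m k.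
case: m => [|m] lt_s.
  by exists 1; rewrite add0n mul1r {2}/qpoch big_geq // mul1r.
case: k lt_s => [|k] lt_s.
  by exists 1; rewrite addn0 mul1r {3}/qpoch big_geq // mulr1.
have [|g Eg] := IHs m k.+1; first by lia.
have [|h Eh] := IHs m.+1 k; first by lia.
exists (g + 'X^(m.+1) * h).
have -> : qpoch (m.+1 + k.+1) =
    qpoch (m + k.+1) * (1 - 'X^(m.+1)) + 'X^(m.+1) * (qpoch (m.+1 + k) * (1 - 'X^(k.+1))).
  rewrite addSn qpochS addSnnS -addSn exprD; ring.
rewrite Eg Eh !qpochS; ring.
Qed.

Lemma qbinomE n m : (m <= n)%N ->
  qbinom n m * (qpoch m * qpoch (n - m)) = qpoch n.
Proof.
move=> le_mn; have [g] := qpoch_dvd m (n - m); rewrite subnKC // => Eg.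
rewrite /qbinom Eg Pdiv.IdomainUnit.mulpK // lead_coefM unitrM.
by rewrite !lead_coef_qpoch.
Qed.

(* To the right of the last descent d the letters increase, so there is no
   excedance there: exc p <= d <= maj p. *)
Lemma exc_le_maj n (p : 'S_n) : (exc p <= maj p)%N.
Proof.
have last_desc (i : 'I_n) : (i < p i)%N -> exists2 d : 'I_n, descent p d & (i <= d)%N.
  move=> lt_ip; apply/exists_inP; apply: contraLR lt_ip.
  rewrite negb_exists_in -leqNgt => /forall_inP noD.
  have [s] := ubnP (n - i)%N; elim: s i noD => // s IHs i noD lt_s.
  have [lt_i1|le_n] := ltnP i.+1 n; last first.
    by have := ltn_ord (p i); lia.
  set j := Ordinal lt_i1.
  have lt_pij : (p i < p j)%N.
    rewrite ltn_neqAle; apply/andP; split.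
      by apply/eqP => /val_inj/perm_inj/(congr1 val) /=; lia.
    rewrite leqNgt; apply/negP => ltp.
    have : descent p i by apply/existsP; exists j; rewrite eqxx.
    by move/noD; rewrite leqnn.
  have : (p j <= j)%N.
    apply: IHs => /=; last by lia.
    by move=> d /noD; rewrite -!ltnNge => lt_di; apply: ltnW.
  by move=> /=; lia.
have [i0 E_i0|noE] := pickP [pred i : 'I_n | (i < p i)%N]; last first.
  suff -> : exc p = 0%N by [].
  by apply/eqP; rewrite cards_eq0; apply/eqP/setP => i; rewrite !inE; exact: noE.
have [d0 D_d0 _] := last_desc _ E_i0.
case: (arg_maxnP (fun i : 'I_n => i : nat) D_d0) => d D_d max_d.
apply: (@leq_trans d.+1); last by rewrite /maj (bigD1 d) //= leq_addr.
have sub : [set i : 'I_n | (i < p i)%N] \subset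
           [set widen_ord (ltn_ord d) i | i : 'I_d.+1].
  apply/subsetP => i; rewrite inE => /last_desc[e D_e le_ie].
  have lt_id : (i < d.+1)%N by apply: leq_trans le_ie (max_d e D_e).
  by apply/imsetP; exists (Ordinal lt_id) => //; apply: val_inj.
by apply: leq_trans (subset_leq_card sub) _; rewrite (leq_trans (leq_imset_card _ _)) // card_ord.
Qed.

(* Main.v *)
(** Let B_n be the sum of t^des q^ai over S_n.  Splitting a permutation at its
    largest letter gives
      B_(n+1) = (1 - t q^n) B_n + t sum_k [n, k]_q q^(n-k) B_k B_(n-k),
    and the same splitting of PRW_(n+1) gives a recursion whose solution is
    1 + t sum_(m >= 1) [n, m]_q B_m, by the q-Leibniz rule for the q-binomial
    convolution.  It remains to see that A_n = B_n.

    Weight a word over the letters 0, 1, ... by q to the sum of its letters and by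
    t per ascent, 1 per descent, 1 + t per plateau.  Cutting at the smallest letter
    shows that (q; q)_n times the weight W_n of the words of length n satisfies the
    recursion of B_n.  On the other side, A_n / (q; q)_n counts pairs (p, s) where s
    is a weakly decreasing word compatible with p; standardization turns the
    permutations compatible with s into a coefficient of the kind appearing in
    MacMahon's master theorem, namely that of x^m, with m the content of s, in a
    product of m_v linear forms for each letter v.  Reading the m_v factors as
    successive exits from v, a walk that starts at the smallest letter a and ends
    when the exits of a are exhausted splits off, and this yields the recursion of
    W_n again.

    Only finitely many letters are used at a time, so the identities of power series
    in q are congruences modulo q^r, for all r. *)
Require Import Defs.
From mathcomp Require Import all_boot all_order all_algebra all_fingroup.
From mathcomp Require Import mpoly ring zify.
Set Implicit Arguments.
Unset Strict Implicit.
Unset Printing Implicit Defensive.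
Import Order.TTheory GRing.Theory.
Local Open Scope ring_scope.

(** * The q-binomial convolution *)

Section QBinomial.
Variables (R : comNzRingType) (q : R).

Definition qfact n : R := \prod_(1 <= i < n.+1) (1 - q ^+ i).

Lemma qfact0 : qfact 0 = 1. Proof. by rewrite /qfact big_geq. Qed.

Lemma qfactS n : qfact n.+1 = qfact n * (1 - q ^+ n.+1).
Proof. by rewrite /qfact big_nat_recr. Qed.

(** The q-binomial coefficient by its Pascal rule, free of division, so that it exists over any
    commutative ring. *)
Fixpoint gbin (n m : nat) : R :=
  match n, m with
  | n'.+1, m'.+1 => q ^+ (n' - m') * gbin n' m' + gbin n' m'.+1
  | 0, _.+1 => 0
  | _, 0 => 1
  end.

Lemma gbin0 n : gbin n 0 = 1. Proof. by case: n. Qed.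

Lemma gbinS n m : gbin n.+1 m.+1 = q ^+ (n - m) * gbin n m + gbin n m.+1.
Proof. by []. Qed.

Lemma gbin_small n m : (n < m)%N -> gbin n m = 0.
Proof.
elim: n m => [|n IHn] [|m] //= lt_nm.
by rewrite !IHn ?mulr0 ?addr0 //; lia.
Qed.

Arguments gbin : simpl never.

Lemma gbinn n : gbin n n = 1.
Proof. by elim: n => // n IHn; rewrite gbinS subnn mul1r IHn gbin_small ?addr0. Qed.

(** Induction on [m + k]: for positive [m] and [k] Pascal's rule reduces the claim to q^k (1 - q^m)
    + (1 - q^k) = 1 - q^(m+k). *)
Lemma gbin_fact m k : gbin (m + k) m * (qfact m * qfact k) = qfact (m + k).
Proof.
have [s] := ubnP (m + k)%N; elim: s m k => // s IHs m k.
case: m => [|m] lt_s; first by rewrite gbin0 qfact0 !mul1r.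
rewrite addSn gbinS addKn.
have Em := IHs m k ltac:(lia).
case: k lt_s Em => [|k] lt_s Em.
  move: Em; rewrite !addn0 (@gbin_small m m.+1) // expr0 mul1r addr0 qfact0 !mulr1.
  by rewrite qfactS mulrA => ->.
have := IHs m.+1 k ltac:(lia).
rewrite addSnnS => Ek.
rewrite [RHS]qfactS mulrDl.
have -> : q ^+ k.+1 * gbin (m + k.+1) m * (qfact m.+1 * qfact k.+1) =
  q ^+ k.+1 * (1 - q ^+ m.+1) * qfact (m + k.+1).
  by rewrite -Em (qfactS m); ring.
have -> : gbin (m + k.+1) m.+1 * (qfact m.+1 * qfact k.+1) =
  (1 - q ^+ k.+1) * qfact (m + k.+1).
  by rewrite -Ek (qfactS k); ring.
have -> : (m + k.+1).+1 = (m.+1 + k.+1)%N by lia.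
rewrite exprD; ring.
Qed.

Definition qconv (f g : nat -> R) n := \sum_(k < n.+1) gbin n k * f k * g (n - k)%N.

Definition qscale (f : nat -> R) n := q ^+ n * f n.

(** The q-Leibniz rule: shifting a sequence is the q-derivative of its q-exponential generating
    function. Pascal's rule splits each term in two. *)
Lemma qconvS f g n :
  qconv f g n.+1 = qconv (fun m => f m.+1) (qscale g) n + qconv f (fun m => g m.+1) n.
Proof.
rewrite /qconv big_ord_recl gbin0 mul1r subn0.
rewrite (eq_bigr (fun k : 'I_n.+1 =>
   gbin n k * f k.+1 * (q ^+ (n - k) * g (n - k)%N)
   + gbin n k.+1 * f k.+1 * g (n - k)%N)); last first.
  by move=> k _; rewrite /= gbinS /bump /= add1n subSS; ring.
rewrite big_split /= addrCA; congr (_ + _).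
rewrite [in RHS]big_ord_recl gbin0 mul1r subn0; congr (_ + _).
rewrite big_ord_recr /= gbin_small // !mul0r addr0.
by apply: eq_bigr => k _; rewrite /bump /= add1n subnSK.
Qed.

Lemma eq_qconv f f' g g' : f =1 f' -> g =1 g' -> qconv f g =1 qconv f' g'.
Proof. by move=> Ef Eg n; apply: eq_bigr => k _; rewrite Ef Eg. Qed.

Lemma qconvDl f f' g n : qconv (fun m => f m + f' m) g n = qconv f g n + qconv f' g n.
Proof. by rewrite /qconv -big_split; apply: eq_bigr => k _ /=; ring. Qed.

Lemma qconvDr f g g' n : qconv f (fun m => g m + g' m) n = qconv f g n + qconv f g' n.
Proof. by rewrite /qconv -big_split; apply: eq_bigr => k _ /=; ring. Qed.

Lemma qconvZl a f g n : qconv (fun m => a * f m) g n = a * qconv f g n.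
Proof. by rewrite /qconv mulr_sumr; apply: eq_bigr => k _ /=; ring. Qed.

Lemma qconvZr a f g n : qconv f (fun m => a * g m) n = a * qconv f g n.
Proof. by rewrite /qconv mulr_sumr; apply: eq_bigr => k _ /=; ring. Qed.

(** Cancelling q-factorials takes the place of dividing by them, so R need not be a field. *)
Hypothesis qfact_reg : forall n, GRing.lreg (qfact n).

Lemma gbin_sym n k : (k <= n)%N -> gbin n k = gbin n (n - k).
Proof.
move=> le_kn; apply: (qfact_reg (n := k)); apply: (qfact_reg (n := (n - k)%N)).
have := gbin_fact k (n - k); have := gbin_fact (n - k) k.
rewrite subnK // subnKC // => E1 E2.
transitivity (qfact n); first by rewrite -E2; ring.
by rewrite -E1; ring.
Qed.

Lemma qconvC f g : qconv f g =1 qconv g f.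
Proof.
move=> n; rewrite /qconv (reindex_inj rev_ord_inj) /=.
apply: eq_bigr => k _; rewrite subSS subKn; last by rewrite -ltnS.
by rewrite -gbin_sym; [ring | rewrite -ltnS].
Qed.

(** Both sides are the q-trinomial coefficient of [i], [j], [k]. *)
Lemma gbin_trinom i j k :
  gbin (i + j + k) (i + j) * gbin (i + j) i = gbin (i + j + k) i * gbin (j + k) j.
Proof.
apply: (qfact_reg (n := i)); apply: (qfact_reg (n := j)); apply: (qfact_reg (n := k)).
transitivity (qfact (i + j + k)).
  by rewrite -(gbin_fact (i + j) k) -(gbin_fact i j); ring.
rewrite -addnA; by rewrite -(gbin_fact i (j + k)) -(gbin_fact j k); ring.
Qed.

Lemma qconvA f g h : qconv f (qconv g h) =1 qconv (qconv f g) h.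
Proof.
move=> n; rewrite /qconv.
(* With [k = i + j] both sides become sums of [F i (k - i)] over [i <= k <= n], taken in either
   order. *)
pose F i j := gbin n i * gbin (n - i) j * f i * g j * h (n - i - j)%N.
transitivity (\sum_(i < n.+1) \sum_(k < n.+1 | (i <= k)%N) F i (k - i)%N).
  apply: eq_bigr => i _; rewrite mulr_sumr.
  rewrite -(big_mkord (fun k => (i <= k)%N) (fun k => F i (k - i)%N)).
  rewrite -(big_mkord xpredT (fun j => gbin n i * f i * (gbin (n - i) j * g j * h (n - i -
    j)%N))).
  rewrite [RHS](big_cat_nat (n := i)) //=; last by case: i => i /=; lia.
  rewrite [X in _ = X + _]big_nat_cond [X in _ = X + _]big_pred0; last by move=> k; lia.
  rewrite add0r -[X in _ = \sum_(X <= _ < _ | _) _]add0n [RHS]big_addn subSn;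
    last by rewrite -ltnS.
  rewrite [RHS]big_mkcond; apply: eq_big_nat => j _.
  rewrite leq_addl addnK /F; ring.
rewrite (exchange_big_dep xpredT) //=; apply: eq_bigr => k _.
rewrite mulr_sumr mulr_suml.
rewrite -(big_mkord (fun i => (i <= k)%N) (fun i => F i (k - i)%N)).
rewrite -(big_mkord xpredT (fun j => gbin n k * (gbin k j * f j * g (k - j)%N) * h (n - k)%N)).
have lt_kn := ltn_ord k.
rewrite (big_cat_nat (n := k.+1)) //= [X in _ + X]big_nat_cond [X in _ + X]big_pred0;
  last by move=> i; lia.
rewrite addr0 big_mkcond; apply: eq_big_nat => i /andP[_]; rewrite ltnS => le_ik.
rewrite le_ik /F -subnDA subnKC //.
have := gbin_trinom i (k - i) (n - k); rewrite subnKC // subnKC; last by lia.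
rewrite (_ : (k - i + (n - k))%N = (n - i)%N); last by lia.
by move=> E; rewrite -E; ring.
Qed.

End QBinomial.

Arguments gbin : simpl never.

(** * The recursion of the q-Eulerian polynomials and its binomial transform *)

Section Eulerian.
Variables (R : comNzRingType) (t q : R).

(* [d] is fuel: see [qEul_recE]. *)
Fixpoint qEul_rec (d n : nat) : R :=
  match d, n with
  | d'.+1, n'.+1 => (1 - t * q ^+ n') * qEul_rec d' n'
                    + t * qconv q (qEul_rec d') (qscale q (qEul_rec d')) n'
  | _, _ => 1
  end.

(** The B_n of the overview, defined by their recursion. [sum_perm_weight] and [word_sum_qEul]
    identify them with sums over permutations and, in the limit, over words. *)
Definition qEul n := qEul_rec n n.

Lemma qEul_recE d n : (n <= d)%N -> qEul_rec d n = qEul n.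
Proof.
suff E k1 k2 m : (m <= k1)%N -> (m <= k2)%N -> qEul_rec k1 m = qEul_rec k2 m.
  by move=> le_nd; apply: E.
elim: k1 k2 m => [|k1 IH] [|k2] [|m] //= le1 le2.
rewrite (IH k2) //; congr (_ + t * _); apply: eq_bigr => i _.
have := ltn_ord i; rewrite ltnS => le_im.
by rewrite /qscale !(IH k2) //; lia.
Qed.

Lemma qEul0 : qEul 0 = 1. Proof. by []. Qed.

Lemma qEulS n : qEul n.+1 = (1 - t * q ^+ n) * qEul n + t * qconv q qEul (qscale q qEul) n.
Proof.
rewrite {1}/qEul /= -/(qEul n); congr (_ + t * _); apply: eq_bigr => i _.
have := ltn_ord i; rewrite ltnS => le_im.
by rewrite /qscale !qEul_recE //; lia.
Qed.

(** This is [tA] with [qEul] in place of [A]. *)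
Definition qbinEul n := 1 + t * \sum_(1 <= m < n.+1) gbin q n m * qEul m.

Hypothesis qfact_reg : forall n, GRing.lreg (qfact q n).

(** The convolution with 1 also has the term [m = 0], equal to [t]; the summand [1 - t] corrects
    it. *)
Lemma qbinEul_conv n :
  qbinEul n = t * qconv q (fun=> 1) qEul n + (1 - t).
Proof.
rewrite qconvC // /qbinEul /qconv [in RHS]big_ord_recl gbin0 qEul0 !mulr1.
rewrite big_add1 big_mkord.
under [X in _ = t * (1 + X) + _]eq_bigr do rewrite mulr1.
ring.
Qed.

(** The Leibniz rule is applied to the convolution of 1 with [qEul]. The shift fixes 1 and acts on
    [qEul] by [qEulS]; associativity then reassembles [qbinEul]. *)
Lemma qbinEulS n : qbinEul n.+1 = qbinEul n + t * qconv q qbinEul (qscale q qEul) n.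
Proof.
pose one (_ : nat) : R := 1; pose bp := qscale q qEul.
rewrite qbinEul_conv qconvS -/bp.
have -> : qconv q one (fun m => qEul m.+1) n =
    qconv q one qEul n - t * qconv q one bp n + t * qconv q one (qconv q qEul bp) n.
  rewrite -!qconvZr -mulN1r -qconvZr -!qconvDr; apply: eq_qconv => // m.
  by rewrite qEulS /bp /qscale; ring.
have -> : qconv q qbinEul bp n = t * qconv q one (qconv q qEul bp) n + (1 - t) * qconv q one bp n.
  rewrite qconvA // -!qconvZl -qconvDl; apply: eq_qconv => // m.
  by rewrite qbinEul_conv mulr1.
rewrite qbinEul_conv -/one.
ring.
Qed.
End Eulerian.

(** * Decomposition of words at the largest letter *)

Fixpoint sdes (s : seq nat) : nat :=
  if s is x :: s' then ((if s' is y :: _ then y < x else false)%N + sdes s')%N else 0%N.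

(* [b] records whether an inversion of [x] with the next letter is admissible:
   either a smaller letter precedes [x], or a larger one has been passed. *)
Fixpoint sadm (b : bool) (x : nat) (s : seq nat) : nat :=
  if s is y :: s' then ((b && (y < x)%N) + sadm (b || (x < y)%N) x s')%N else 0%N.

(* [b] tells whether the first letter of [s] is preceded by a smaller one. *)
Fixpoint sai (b : bool) (s : seq nat) : nat :=
  if s is x :: s' then
    (sadm b x s' + sai (if s' is y :: _ then (x < y)%N else false) s')%N
  else 0%N.

(** The PRW condition on words, with [a] in the role of the letter 1. *)
Fixpoint sprw (a : nat) (s : seq nat) : bool :=
  if s is x :: s' then
    if s' is y :: _ then (if (x < y)%N then x == a else sprw a s') else true
  else true.

Definition sinv (s1 s2 : seq nat) : nat := \sum_(x <- s1) \sum_(y <- s2) (y < x)%N.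

Lemma sdes_max M s1 s2 : all (fun x => x < M)%N s1 -> all (fun x => x < M)%N s2 ->
  sdes (s1 ++ M :: s2) = (sdes s1 + (s2 != [::]) + sdes s2)%N.
Proof.
move=> lt1 lt2; elim: s1 lt1 => [_|x s1 IH] /=.
  by case: s2 lt2 => //= y s2 /andP[->].
case/andP=> ltx lt1; rewrite IH //.
case: s1 lt1 {IH} => [|y s1] /=; last by lia.
by rewrite ltnNge (ltnW ltx).
Qed.

Lemma sadm_true x s : sadm true x s = (\sum_(y <- s) (y < x)%N)%N.
Proof. by elim: s => [|y s IH] /=; rewrite ?big_nil // big_cons IH. Qed.

Lemma sadm_max M b x s1 s2 : (x < M)%N ->
  sadm b x (s1 ++ M :: s2) = (sadm b x s1 + \sum_(y <- s2) (y < x)%N)%N.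
Proof.
move=> ltx; elim: s1 b => [|y s1 IH] b /=; last by rewrite IH addnA.
by rewrite ltx orbT sadm_true ltnNge (ltnW ltx) andbF.
Qed.

(** An inversion across the largest letter [M] is admissible by condition (ii). The inversions
    starting at [M] are admissible exactly when a smaller letter precedes [M]: [s1] is nonempty or
    [b] holds. *)
Lemma sai_max M b s1 s2 : all (fun x => x < M)%N s1 -> all (fun x => x < M)%N s2 ->
  sai b (s1 ++ M :: s2) =
  (sai b s1 + sinv s1 s2 + (if (s1 != [::]) || b then size s2 else 0) + sai false s2)%N.
Proof.
move=> lt1 lt2; elim: s1 b lt1 => [|x s1 IH] b /=.
  move=> _; rewrite /sinv big_nil.
  have -> : sadm b M s2 = (if b then size s2 else 0)%N.
    elim: s2 lt2 b => [|y s2 IH] /=; first by move=> _ [].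
    case/andP=> lty lt2 b; rewrite lty andbT IH // [(M < y)%N]ltnNge (ltnW lty) orbF.
    by case: b.
  congr (_ + sai _ _)%N; case: s2 lt2 => //= y s2 /andP[lty _].
  by apply/negbTE; rewrite -leqNgt ltnW.
case/andP=> ltx lt1; rewrite sadm_max // IH // /sinv big_cons.
by case: s1 lt1 {IH} => [|y s1] /=; rewrite ?big_nil ?ltx; lia.
Qed.

(** If [s1] is nonempty, the first ascent starts in [s1]. Either [s1] itself has an ascent, which
    decides, or [s1] decreases weakly and the ascent goes from its last letter to [M]; that letter
    is the least of [s1], so it is [a] exactly when [a] occurs in [s1]. *)
Lemma sprw_max a M s1 s2 : all (fun x => a <= x < M)%N s1 -> all (fun x => x < M)%N s2 ->
  sprw a (s1 ++ M :: s2) = if s1 is [::] then sprw a s2 else (a \in s1) && sprw a s1.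
Proof.
move=> lt1 lt2; elim: s1 lt1 => [_|x s1 IH] /=.
  by case: s2 lt2 => //= y s2 /andP[lty _]; rewrite ltnNge (ltnW lty).
case/andP=> /andP[leax ltx] lt1; have {IH} := IH lt1.
case: s1 lt1 => [_ _|y s1] /=; first by rewrite ltx inE andbT eq_sym.
case/andP=> /andP[leay lty] lt1 ->.
rewrite [in RHS]inE (eq_sym a); case: (ltnP x y) => le_xy.
  by case: (x == a); rewrite ?andbF.
case: (eqVneq x a) => //= xa; rewrite [a \in _]inE (_ : a == y) //.
by rewrite eqn_leq leay -xa le_xy.
Qed.

(** An arrangement of [X] amounts to the set [Y] of letters left of [M] together with the
    arrangements of both sides. *)
Lemma big_permutations_split (R : nmodType) (N : nat) (X : {set 'I_N}) (M : 'I_N)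
    (F : seq 'I_N -> R) : M \in X ->
  \sum_(s <- permutations (enum X)) F s =
  \sum_(Y : {set 'I_N} | Y \subset X :\ M)
     \sum_(s1 <- permutations (enum Y))
       \sum_(s2 <- permutations (enum (X :\ M :\: Y))) F (s1 ++ M :: s2).
Proof.
move=> MX.
pose L Y := [seq (s1, s2) | s1 <- permutations (enum (Y : {set 'I_N})),
                            s2 <- permutations (enum (X :\ M :\: Y))].
transitivity (\sum_(Y <- enum (powerset (X :\ M))) \sum_(st <- L Y) F (st.1 ++ M :: st.2)).
  rewrite -(big_allpairs_dep (h := fun (Y : {set 'I_N}) (st : seq 'I_N * seq 'I_N) => st.1 ++ M
    :: st.2)).
  apply: perm_big; apply: uniq_perm; first exact: permutations_uniq.
    apply: allpairs_uniq_dep => [|Y _|]; first exact: enum_uniq.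
      by apply: allpairs_uniq => [||[? ?] [? ?] _ _ /= [-> ->] //]; apply: permutations_uniq.
    move=> _ _ /allpairsPdep[Y1 [[u1 v1] [Y1X uv1 ->]]] /allpairsPdep[Y2 [[u2 v2] [Y2X uv2
      ->]]] /= E.
    have aux Y u v : Y \in enum (powerset (X :\ M)) -> (u, v) \in L Y -> M \notin u /\ Y = [set
      x in u].
      rewrite mem_enum inE => sYX /allpairsP[[u' v'] [/= u'P _ [-> _]]].
      have Eu : Y = [set x in u'].
        apply/setP => x; rewrite inE (perm_mem (_ : perm_eq u' (enum Y))) ?mem_enum //.
        by rewrite -mem_permutations.
      split=> //; apply/negP => Mu; have := subsetP sYX M; rewrite Eu !inE eqxx Mu.
      by move/(_ isT).
    have [M1 E1] := aux _ _ _ Y1X uv1; have [M2 E2] := aux _ _ _ Y2X uv2.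
    (* The index of [M] is the length of the left word, as [M] does not occur there. *)
    have Es : size u1 = size u2.
      have := congr1 (index M) E; rewrite !index_cat (negbTE M1) (negbTE M2) /= eqxx.
      by rewrite !addn0.
    have := congr1 (take (size u1)) E; rewrite take_size_cat // Es take_size_cat // => Eu.
    have := congr1 (drop (size u1)) E; rewrite drop_size_cat // Es drop_size_cat // => -[Ev].
    by rewrite E1 E2 Eu Ev.
  move=> s; rewrite mem_permutations; apply/idP/allpairsPdep => [Ps|].
    have Ms : M \in s by rewrite (perm_mem Ps) mem_enum.
    have Us : uniq s by rewrite (perm_uniq Ps) enum_uniq.
    case/splitPr: Ms Ps Us => u v Ps Us.
    have Xs x : (x \in X) = (x \in u ++ M :: v) by rewrite (perm_mem Ps) mem_enum.
    move: Us; rewrite cat_uniq /= negb_or => /and4P[Uu /andP[Mu dis] Mv Uv].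
    exists [set x in u]; exists (u, v); split=> //.
      rewrite mem_enum inE; apply/subsetP => x; rewrite !inE => xu.
      rewrite Xs mem_cat xu andbT; apply/eqP => xM; by rewrite -xM xu in Mu.
    apply/allpairsP; exists (u, v); split=> //=; rewrite mem_permutations.
      by apply: uniq_perm => //; [exact: enum_uniq | move=> x; rewrite mem_enum inE].
    apply: uniq_perm => //; first exact: enum_uniq.
    move=> x; rewrite mem_enum !inE Xs mem_cat inE.
    case: (eqVneq x M) => [->|_] /=; first by rewrite (negbTE Mv) andbF.
    case xu: (x \in u) => //=; apply/negP => xv.
    by move/hasP: dis; apply; exists x.
  case=> Y [[u v] [YX /allpairsP[[u' v'] [/= Pu Pv [-> ->]]] ->]] /=.
  move: Pu Pv YX; rewrite !mem_permutations mem_enum inE => Pu Pv YX.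
  have Yu x : (x \in u') = (x \in Y) by rewrite (perm_mem Pu) mem_enum.
  have Yv x : (x \in v') = [&& x \notin Y, x != M & x \in X].
    by rewrite (perm_mem Pv) mem_enum !inE.
  have YXM x : x \in Y -> (x != M) && (x \in X) by move/(subsetP YX); rewrite !inE.
  apply: uniq_perm; last 1 first.
  - move=> x; rewrite mem_cat inE Yu Yv mem_enum.
    case: (eqVneq x M) => [->|_] /=; first by rewrite MX orbT.
    by case xY: (x \in Y) => //=; case/andP: (YXM x xY) => _ ->.
  - rewrite cat_uniq /= (perm_uniq Pu) (perm_uniq Pv) !enum_uniq Yv eqxx /= andbF /= andbT.
    rewrite Yu negb_or; apply/andP; split.
      by apply/negP => YM; have := YXM M YM; rewrite eqxx.
    by apply/hasPn => x; rewrite Yv => /andP[]; rewrite /= Yu.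
  exact: enum_uniq.
rewrite big_enum /=; apply: eq_big => [Y|Y _]; first by rewrite inE.
by rewrite big_allpairs.
Qed.

Definition setinv (N : nat) (Y Z : {set 'I_N}) : nat :=
  \sum_(x in Y) \sum_(y in Z) (y < x)%N.

Lemma big_subsetU1 (R : nmodType) (T : finType) (X : {set T}) (M : T) (F : {set T} -> R) :
  M \notin X ->
  \sum_(Y : {set T} | Y \subset M |: X) F Y =
  \sum_(Y : {set T} | Y \subset X) F Y + \sum_(Y : {set T} | Y \subset X) F (M |: Y).
Proof.
move=> MX; rewrite (bigID (fun Y : {set T} => M \notin Y)) /=; congr (_ + _).
  apply: eq_bigl => Y; apply/andP/idP => [[sY MY]|sY].
    apply/subsetP => x xY; have := subsetP sY x xY; rewrite !inE.
    by case/predU1P => // xM; rewrite -xM xY in MY.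
  split; first by rewrite (subset_trans sY) // subsetUr.
  by apply: contra MX; apply/subsetP.
rewrite (reindex_onto (fun Y => M |: Y) (fun Y => Y :\ M)) /=; last first.
  by move=> Y /andP[_ /negPn MY]; rewrite setD1K.
apply: eq_bigl => Y; rewrite setU11 andbT.
apply/andP/idP => [[sY /eqP EY]|sY].
  rewrite -EY; apply/subsetP => x; rewrite !inE => /andP[xM /orP[/eqP xM'|xY]].
    by rewrite xM' eqxx in xM.
  by have := subsetP sY x; rewrite !inE xY orbT (negbTE xM) /=; apply.
split; first by rewrite setUS.
rewrite setU1K //; by apply: contra MX; apply/subsetP.
Qed.

Section Sums.
Variables (R : comNzRingType) (t q : R).

Lemma setinv_max N (X Y : {set 'I_N}) M : Y \subset X -> M \notin X ->
  (forall x, x \in X -> (x < M)%N) ->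
  setinv Y ((M |: X) :\: Y) = setinv Y (X :\: Y)
  /\ setinv (M |: Y) ((M |: X) :\: (M |: Y)) = (#|X| - #|Y| + setinv Y (X :\: Y))%N.
Proof.
move=> sYX MX ltM; have MY : M \notin Y by apply: contra MX; apply/subsetP.
split.
  apply: eq_bigr => x xY.
  have -> : (M |: X) :\: Y = M |: (X :\: Y).
    by apply/setP => z; rewrite !inE; case: eqVneq => [->|]; rewrite ?MY.
  rewrite big_setU1 ?inE ?(negbTE MX) ?andbF //=.
  by rewrite ltnNge (ltnW (ltM x _)) //; apply: (subsetP sYX).
have -> : (M |: X) :\: (M |: Y) = X :\: Y.
  apply/setP => z; rewrite !inE negb_or; case: eqVneq => [->|] //=.
  by rewrite (negbTE MX) andbF.
rewrite /setinv big_setU1 //=; congr (_ + _)%N.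
rewrite -(setIidPr sYX) -cardsD (setIidPr sYX) -sum1_card; apply: eq_bigr => y.
by rewrite inE => /andP[_ yX]; rewrite ltM.
Qed.

(** The q-binomial coefficient counts subsets by inversions against their complement. Placing the
    largest element outside or inside the subset yields the two terms of Pascal's rule. *)
Lemma sum_subset_inv N (X : {set 'I_N}) (F : nat -> R) :
  \sum_(Y : {set 'I_N} | Y \subset X) q ^+ setinv Y (X :\: Y) * F #|Y| =
  \sum_(k < #|X|.+1) gbin q #|X| k * F k.
Proof.
move En : #|X| => n; elim: n X En F => [|n IH] X En F.
  move/eqP: En; rewrite cards_eq0 => /eqP ->.
  rewrite (big_pred1 set0) => [|Y]; last by rewrite subset0.
  by rewrite big_ord_recl big_ord0 /setinv big_set0 cards0 addr0 /= expr0.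
have [x0 x0X] : exists x, x \in X by apply/set0Pn; rewrite -cards_eq0 En.
case: (arg_maxnP (fun i : 'I_N => i : nat) x0X) => M MX maxM.
have EX := setD1K MX; set Z := X :\ M in EX.
have MZ : M \notin Z by rewrite !inE eqxx.
have EZ : #|Z| = n by move: En; rewrite -EX cardsU1 MZ add1n => -[].
have ltM x : x \in Z -> (x < M)%N.
  rewrite !inE => /andP[neq xX]; rewrite ltn_neqAle; apply/andP; split=> //.
  exact: maxM.
rewrite -EX big_subsetU1 //.
rewrite (eq_bigr (fun Y => q ^+ setinv Y (Z :\: Y) * F #|Y|)); last first.
  by move=> Y sY; rewrite (setinv_max sY MZ ltM).1.
rewrite IH // [X in _ + X](eq_bigr (fun Y => q ^+ setinv Y (Z :\: Y) *
   ((fun k => q ^+ (n - k) * F k.+1) #|Y|))); last first.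
  move=> Y sY; rewrite (setinv_max sY MZ ltM).2 EZ exprD cardsU1.
  rewrite (contra (subsetP sY M)) // add1n; ring.
rewrite (IH Z EZ (fun k => q ^+ (n - k) * F k.+1)).
rewrite [in RHS]big_ord_recl gbin0.
rewrite [in RHS](eq_bigr (fun k : 'I_n.+1 =>
   gbin q n k * (q ^+ (n - k) * F k.+1) + gbin q n k.+1 * F k.+1)); last first.
  by move=> k _; rewrite lift0 gbinS; ring.
rewrite big_split /= [X in _ = _ + (_ + X)]big_ord_recr /= gbin_small // mul0r addr0.
by rewrite [X in X + _ = _]big_ord_recl gbin0 -addrA [X in _ + X = _]addrC.
Qed.

Definition perm_weight (s : seq nat) : R := t ^+ sdes s * q ^+ sai false s.

Lemma sinv_setinv N (Y Z : {set 'I_N}) s1 s2 :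
  perm_eq s1 (enum Y) -> perm_eq s2 (enum Z) ->
  sinv (map val s1) (map val s2) = setinv Y Z.
Proof.
move=> P1 P2; rewrite /sinv big_map (perm_big _ P1) /= big_enum; apply: eq_bigr => x _.
by rewrite big_map (perm_big _ P2) /= big_enum.
Qed.

Lemma perm_weight_max N (Y Z : {set 'I_N}) (M : 'I_N) s1 s2 :
  (forall x, x \in Y -> x < M)%N -> (forall x, x \in Z -> x < M)%N ->
  perm_eq s1 (enum Y) -> perm_eq s2 (enum Z) ->
  perm_weight (map val (s1 ++ M :: s2)) =
  q ^+ setinv Y Z * ((if (0 < #|Y|)%N then q ^+ #|Z| else 1)
     * (if (0 < #|Z|)%N then t else 1))
  * (perm_weight (map val s1) * perm_weight (map val s2)).
Proof.
move=> ltY ltZ P1 P2; rewrite map_cat /= /perm_weight.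
have lt1 : all (fun x => x < M)%N (map val s1).
  by rewrite all_map; apply/allP => x; rewrite (perm_mem P1) mem_enum; apply: ltY.
have lt2 : all (fun x => x < M)%N (map val s2).
  by rewrite all_map; apply/allP => x; rewrite (perm_mem P2) mem_enum; apply: ltZ.
rewrite sdes_max // sai_max // (sinv_setinv P1 P2) orbF !exprD size_map.
have nilE (s : seq 'I_N) : (map val s != [::]) = (0 < size s)%N by case: s.
rewrite !nilE (perm_size P1) (perm_size P2) -!cardE.
by do 2!case: ifP => _ /=; rewrite ?expr0 ?expr1; ring.
Qed.

Lemma sum_perm_weight N (X : {set 'I_N}) :
  \sum_(s <- permutations (enum X)) perm_weight (map val s) = qEul t q #|X|.
Proof.
move En : #|X| => n; elim/ltn_ind: n X En => -[|n] IH X En.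
  move/eqP: En; rewrite cards_eq0 => /eqP ->.
  by rewrite enum_set0 big_seq1 /perm_weight /= mulr1.
have [x0 x0X] : exists x, x \in X by apply/set0Pn; rewrite -cards_eq0 En.
case: (arg_maxnP (fun i : 'I_N => i : nat) x0X) => M MX maxM.
have EX := setD1K MX; set Z := X :\ M in EX.
have MZ : M \notin Z by rewrite !inE eqxx.
have EZ : #|Z| = n by move: En; rewrite -EX cardsU1 MZ add1n => -[].
have ltM x : x \in Z -> (x < M)%N.
  rewrite !inE => /andP[neq xX]; rewrite ltn_neqAle; apply/andP; split=> //.
  exact: maxM.
rewrite (big_permutations_split _ MX) -/Z.
(* For [n > 0] the terms [k = 0] and [k = n] carry [t] and [1], where the convolution in [qEulS] has
   [t q^n] and [t]. The difference is the summand [(1 - t q^n) qEul n]. *)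
pose c k := (if (0 < k)%N then q ^+ (n - k) else 1) * (if (0 < n - k)%N then t else 1)
  * (qEul t q k * qEul t q (n - k)).
transitivity (\sum_(Y : {set 'I_N} | Y \subset Z) q ^+ setinv Y (Z :\: Y) * c #|Y|).
  apply: eq_bigr => Y sY.
  have leY : (#|Y| <= n)%N by rewrite -EZ subset_leq_card.
  have EZY : #|Z :\: Y| = (n - #|Y|)%N by rewrite cardsD (setIidPr sY) EZ.
  rewrite /c -(IH #|Y| _ Y) // -(IH (n - #|Y|)%N _ (Z :\: Y)) //; last by rewrite ltnS leq_subr.
  rewrite big_distrlr mulrA mulr_sumr [LHS]big_seq [RHS]big_seq; apply: eq_bigr => s1.
  rewrite mem_permutations => P1; rewrite mulr_sumr [LHS]big_seq [RHS]big_seq.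
  apply: eq_bigr => s2; rewrite mem_permutations => P2.
  rewrite (perm_weight_max _ _ P1 P2) ?EZY //.
    by move=> x /(subsetP sY)/ltM.
  by move=> x; rewrite inE => /andP[_ /ltM].
rewrite sum_subset_inv EZ qEulS /qconv /qscale {IH EZ En}/c.
case: n => [|n].
  rewrite !big_ord_recl !big_ord0 /= !expr0 !gbin0 !qEul0; ring.
rewrite [in LHS]big_ord_recl [in RHS]big_ord_recl [X in _ + X = _]big_ord_recr.
rewrite [X in _ = _ + _ * (_ + X)]big_ord_recr /= !gbin0 !qEul0 !subn0 /bump !add1n subnn.
rewrite !gbinn expr0 qEul0 /=.
set S := \sum_(i < n) _; set S' := \sum_(i < n) _.
have -> : S = t * S'.
  rewrite /S' mulr_sumr; apply: eq_bigr => i _; rewrite /bump !add1n /= subSS.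
  by rewrite subn_gt0 ltn_ord; ring.
ring.
Qed.
End Sums.

(** * Arrangements satisfying the PRW condition *)

Section SumPRW.
Variables (R : comNzRingType) (t q : R).
Hypothesis qfact_reg : forall n, GRing.lreg (qfact q n).

Lemma setinv_min N (a : 'I_N) (Y Z : {set 'I_N}) :
  a \notin Y -> (forall x, x \in Z -> a <= x)%N -> setinv (a |: Y) Z = setinv Y Z.
Proof.
move=> aY lea; rewrite /setinv big_setU1 //= big1 // => y yZ.
by rewrite ltnNge lea.
Qed.

(** If the largest letter [M] comes first, a PRW arrangement of the rest follows. Otherwise [a] must
    stand left of [M], the left word satisfies the condition again, and the right word is arbitrary.
    This is the recursion [qbinEulS]. *)
Lemma sum_perm_weight_prw N (X : {set 'I_N}) (a : 'I_N) n :
  #|X| = n.+1 -> a \in X -> (forall x, x \in X -> a <= x)%N ->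
  \sum_(s <- permutations (enum X)) (sprw a (map val s))%:R * perm_weight t q (map val s) =
  qbinEul t q n.
Proof.
elim/ltn_ind: n X => -[|n] IH X En aX lea.
  have /cards1P[x EX] : #|X| == 1%N by rewrite En.
  rewrite EX enum_set1 (_ : permutations [:: x] = [:: [:: x]]) // big_seq1.
  by rewrite /qbinEul big_geq // /perm_weight /= !mul1r mulr0 addr0.
case: (arg_maxnP (fun i : 'I_N => i : nat) aX) => M MX maxM.
have EX := setD1K MX; set Z := X :\ M in EX.
have MZ : M \notin Z by rewrite !inE eqxx.
have EZ : #|Z| = n.+1 by move: En; rewrite -EX cardsU1 MZ add1n => -[].
have ltM x : x \in Z -> (x < M)%N.
  rewrite !inE => /andP[neq xX]; rewrite ltn_neqAle; apply/andP; split=> //.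
  exact: maxM.
have aZ : a \in Z.
  rewrite !inE aX andbT; apply/eqP => aM.
  have /card_gt0P[x xZ] : (0 < #|Z|)%N by rewrite EZ.
  have := ltM x xZ; have := lea x; rewrite -EX inE xZ orbT => /(_ isT).
  by rewrite aM ltnNge => ->.
have leZ x : x \in Z -> (a <= x)%N by rewrite inE => /andP[_ /lea].
have splitE (Y : {set 'I_N}) (s1 s2 : seq 'I_N) : Y \subset Z -> s1 \in permutations (enum Y) ->
    s2 \in permutations (enum (Z :\: Y)) ->
  (sprw a (map val (s1 ++ M :: s2)))%:R * perm_weight t q (map val (s1 ++ M :: s2)) =
  (if Y == set0 then t * ((sprw a (map val s2))%:R * perm_weight t q (map val s2)) else
   (a \in Y)%:R * (q ^+ setinv Y (Z :\: Y) * (q ^+ (n.+1 - #|Y|) *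
     (if (0 < n.+1 - #|Y|)%N then t else 1))
   * ((sprw a (map val s1))%:R * perm_weight t q (map val s1) * perm_weight t q (map val s2)))).
  move=> sY; rewrite !mem_permutations => P1 P2.
  have EZY : #|Z :\: Y| = (n.+1 - #|Y|)%N by rewrite cardsD (setIidPr sY) EZ.
  have memY x : (x \in s1) = (x \in Y) by rewrite (perm_mem P1) mem_enum.
  have memZ x : (x \in s2) = (x \in Z :\: Y) by rewrite (perm_mem P2) mem_enum.
  rewrite (perm_weight_max t q _ _ P1 P2) ?EZY; first last.
  - by move=> x; rewrite inE => /andP[_ /ltM].
  - by move=> x /(subsetP sY)/ltM.
  rewrite map_cat /= sprw_max; first last.
  - by rewrite all_map; apply/allP => x; rewrite memZ inE => /andP[_ /ltM].
  - rewrite all_map; apply/allP => x; rewrite memY => /(subsetP sY) xZ /=.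
    by rewrite leZ // ltM.
  have szY := perm_size P1; rewrite -cardE in szY.
  have mema : (val a \in map val s1) = (a \in Y) by rewrite mem_map ?memY //; apply: val_inj.
  rewrite -cards_eq0 -szY; case: s1 szY P1 memY mema => [|x s1] szY P1 memY mema /=.
    have -> : Y = set0 by apply/eqP; rewrite -cards_eq0 -szY.
    rewrite /setinv big_set0 /= /perm_weight /=; ring.
  rewrite [_ \in _]mema; by case: (a \in Y) => /=; ring.
rewrite (big_permutations_split _ MX) -/Z.
have aZa : a \notin Z :\ a by rewrite !inE eqxx.
have EZa : #|Z :\ a| = n by move: EZ; rewrite (cardsD1 a) aZ add1n => -[].
rewrite -{1}(setD1K aZ) big_subsetU1 //.
have sZa (Y : {set 'I_N}) : Y \subset Z :\ a -> Y \subset Z.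
  by move=> sY; apply: subset_trans sY (subD1set _ _).
have aY (Y : {set 'I_N}) : Y \subset Z :\ a -> a \notin Y by move=> sY; apply: contra aZa;
  apply/subsetP.
rewrite (bigD1 set0) ?sub0set //= [X in _ + X + _]big1 ?addr0; last first.
  move=> Y /andP[sY nz]; rewrite big_seq big1 // => s1 P1; rewrite big_seq big1 // => s2 P2.
  by rewrite (splitE Y) ?sZa // (negbTE nz) (negbTE (aY Y sY)) mul0r.
(* The first summand belongs to [M] in front. In the second, [Y] is the set of letters other than
   [a] left of [M], so a left word has [#|Y| + 1] letters and contributes [qbinEul] at [#|Y|]. *)
transitivity (t * qbinEul t q n + \sum_(Y : {set 'I_N} | Y \subset Z :\ a)
   q ^+ setinv Y (Z :\ a :\: Y) * (fun k => (q ^+ (n - k) * (if (0 < n - k)%N then t else 1))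
     * (qbinEul t q k * qEul t q (n - k))) #|Y|).
  congr (_ + _).
    rewrite enum_set0 big_seq1 setD0.
    rewrite -(IH n _ Z) // mulr_sumr [LHS]big_seq [RHS]big_seq; apply: eq_bigr => s sP.
    by rewrite (splitE set0 [::] s) ?sub0set ?eqxx ?enum_set0 ?inE // setD0.
  apply: eq_bigr => Y sY.
  have cY : #|a |: Y| = #|Y|.+1 by rewrite cardsU1 aY.
  have leY : (#|Y| <= n)%N by rewrite -EZa subset_leq_card.
  have sY' : a |: Y \subset Z by rewrite -(setD1K aZ) setUS.
  have nz : a |: Y != set0 by rewrite -cards_eq0 cY.
  have EZY : Z :\ a :\: Y = Z :\: (a |: Y) by rewrite setDDl.
  have cZY : #|Z :\: (a |: Y)| = (n - #|Y|)%N by rewrite cardsD (setIidPr sY') EZ cY subSS.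
  rewrite EZY -(setinv_min (aY Y sY)); last by move=> x; rewrite inE => /andP[_ /leZ].
  rewrite /= -{3}cZY -{1}(IH #|Y| _ (a |: Y)) // ?setU11 //; last by move=> x /(subsetP sY')/leZ.
  rewrite -{1}(sum_perm_weight t q (Z :\: (a |: Y))) big_distrlr mulrA mulr_sumr.
  rewrite [LHS]big_seq [RHS]big_seq; apply: eq_bigr => s1 P1.
  rewrite mulr_sumr [LHS]big_seq [RHS]big_seq; apply: eq_bigr => s2 P2.
  by rewrite (splitE (a |: Y)) // (negbTE nz) setU11 mul1r cY subSS.
rewrite (sum_subset_inv q (Z :\ a) (fun k => q ^+ (n - k) * (if (0 < n - k)%N then t else 1)
  * (qbinEul t q k * qEul t q (n - k)))) EZa qbinEulS // /qconv /qscale.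
rewrite big_ord_recr [in RHS]big_ord_recr /= subnn !gbinn expr0 qEul0.
set S := \sum_(i < n) _; set S' := \sum_(i < n) _.
have -> : S = t * S'.
  by rewrite /S' mulr_sumr; apply: eq_bigr => i _; rewrite subn_gt0 ltn_ord; ring.
rewrite ltnn; ring.
Qed.
End SumPRW.

(** * One-line notation of permutations *)

Definition perm_seq n (p : 'S_n) : seq 'I_n := [seq p i | i <- enum 'I_n].

Lemma big_perm_seq (R : nmodType) n (F : seq 'I_n -> R) :
  \sum_(p : 'S_n) F (perm_seq p) = \sum_(s <- permutations (enum [set: 'I_n])) F s.
Proof.
have -> : \sum_(p : 'S_n) F (perm_seq p) = \sum_(s <- [seq perm_seq p | p : 'S_n]) F s.
  by rewrite big_map big_enum.
have inj : injective (@perm_seq n).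
  move=> p1 p2 /eq_in_map E; apply/permP => i; apply: E; exact: mem_enum.
apply: perm_big; apply: uniq_perm;
  [by rewrite map_inj_uniq // enum_uniq|exact: permutations_uniq|].
move=> s; rewrite mem_permutations; apply/mapP/idP => [[p _ ->]|Ps].
  apply: uniq_perm; [by rewrite map_inj_uniq ?enum_uniq //; apply: perm_inj|exact: enum_uniq|].
  move=> i; rewrite mem_enum inE; apply/mapP; exists ((p^-1)%g i); first by rewrite mem_enum.
  by rewrite permKV.
have sz : size s == n by rewrite (perm_size Ps) -cardE cardsT card_ord.
have Us : uniq s by rewrite (perm_uniq Ps) enum_uniq.
pose f i := tnth (Tuple sz) i.
have fI : injective f by apply/tuple_uniqP.
exists (perm fI); first by rewrite mem_enum.
rewrite /perm_seq (eq_map (permE fI)) /f.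
exact: esym (map_tnth_enum (Tuple sz)).
Qed.

Lemma nth_perm_seq n (p : 'S_n) (i : 'I_n) : nth 0%N (map val (perm_seq p)) i = p i.
Proof.
rewrite -map_comp (nth_map i) /=; last by rewrite size_enum_ord.
by rewrite nth_ord_enum.
Qed.

Lemma size_perm_seq n (p : 'S_n) : size (map val (perm_seq p)) = n.
Proof. by rewrite 2!size_map size_enum_ord. Qed.

Lemma sdesE s : sdes s =
  (\sum_(0 <= i < size s) (i.+1 < size s) && (nth 0 s i.+1 < nth 0 s i))%N.
Proof.
elim: s => [|x s IH]; first by rewrite big_geq.
rewrite [size _]/= big_nat_recl // [LHS]/= IH; congr (_ + _)%N; by case: s {IH}.
Qed.

Lemma sadmE b x s : sadm b x s =
  (\sum_(0 <= j < size s)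
    ((nth 0 s j < x) && (b || has (fun k => x < nth 0 s k) (iota 0 j))))%N.
Proof.
elim: s b => [|y s IH] b; first by rewrite big_geq.
rewrite [size _]/= big_nat_recl // [LHS]/= IH orbF andbC; congr (_ + _)%N.
apply: eq_bigr => j _ /=; rewrite orbA; congr (_ && (_ || _) : nat).
by rewrite -[1%N]addn0 iotaDl has_map.
Qed.

Lemma saiE b s : sai b s =
  (\sum_(0 <= i < size s) \sum_(0 <= j < size s)
    [&& i < j, nth 0 s j < nth 0 s i &
      (if i is i'.+1 then nth 0 s i' < nth 0 s i else b)
      || has (fun k => (i < k) && (nth 0 s i < nth 0 s k)) (iota 0 j)])%N.
Proof.
elim: s b => [|x s IH] b; first by rewrite big_geq.
rewrite [size _]/= big_nat_recl // [LHS]/= IH sadmE; congr (_ + _)%N.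
  rewrite big_nat_recl //= add0n; apply: eq_bigr => j _ /=.
  by rewrite -[1%N]addn0 iotaDl has_map.
rewrite [LHS]big_nat_cond [RHS]big_nat_cond; apply: eq_bigr => i /andP[/andP[_ lti] _].
rewrite big_nat_recl //= add0n; apply: eq_bigr => j _ /=.
rewrite ltnS -[1%N]addn0 iotaDl has_map; congr [&& _, _ & _ || _].
by case: i lti => // lti; case: s lti {IH}.
Qed.

Lemma sprwP a s :
  reflect (forall i, i.+1 < size s -> (nth 0 s i < nth 0 s i.+1) ->
     (forall j, j < i -> nth 0 s j.+1 <= nth 0 s j) -> nth 0 s i = a)%N (sprw a s).
Proof.
elim: s => [|x [|y s] IH]; [by constructor..|].
rewrite [sprw _ _]/=; case: (ltnP x y) => le_xy.
  apply: (iffP eqP) => [xa [|i] // _ _ /(_ 0%N isT)|/(_ 0%N)]; last exact.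
  by rewrite /= leqNgt le_xy.
apply: (iffP IH) => H i.
  case: i => [|i]; first by move=> _ /=; rewrite ltnNge le_xy.
  by move=> lti lt lej; apply: H => // j ltj; apply: (lej j.+1).
by move=> lti lt lej; apply: (H i.+1) => // -[|j] //; apply: lej.
Qed.

Lemma des_perm_seq n (p : 'S_n) : sdes (map val (perm_seq p)) = des p.
Proof.
rewrite sdesE size_perm_seq big_mkord /des -sum1_card [RHS]big_mkcond /=.
apply: eq_bigr => i _; rewrite inE nth_perm_seq.
have [lti|gei] := ltnP i.+1 n; last first.
  by rewrite (_ : descent p i = false) //; apply/existsP => -[j /andP[/eqP]]; case: j => j /=;
    lia.
have -> : nth 0%N (map val (perm_seq p)) i.+1 = p (Ordinal lti) by rewrite -nth_perm_seq.
have -> : descent p i = (p (Ordinal lti) < p i)%N.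
  apply/existsP/idP => [[j /andP[/eqP Ej]]|lt]; last by exists (Ordinal lti); rewrite eqxx.
  by rewrite (_ : j = Ordinal lti) //; apply: val_inj.
by case: ifP.
Qed.

Lemma ai_perm_seq n (p : 'S_n) : sai false (map val (perm_seq p)) = ai p.
Proof.
rewrite saiE size_perm_seq big_mkord /ai -sum1_card [RHS]big_mkcond /=.
rewrite [RHS](eq_bigr (fun ij => (admissible p ij.1 ij.2 : nat))); last first.
  by move=> ij _; rewrite inE; case: ifP.
rewrite -(pair_bigA _ (fun i j => (admissible p i j : nat))) /=.
apply: eq_bigr => i _; rewrite big_mkord; apply: eq_bigr => j _.
rewrite !nth_perm_seq /admissible /inversion -andbA.
have -> : [exists k : 'I_n, (k.+1 == i :> nat) && (p k < p i)%N] =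
    (if (i : nat) is i'.+1 then nth 0 (map val (perm_seq p)) i' < p i else false)%N :> bool.
  case: i => -[|i] lti /=.
    by apply/existsP => -[k].
  pose k := Ordinal (ltnW lti); rewrite (nth_perm_seq p k).
  apply/existsP/idP => [[k' /andP[/eqP [Ek]]]|lt]; last by exists k; rewrite eqxx.
  by rewrite (_ : k' = k) //; apply: val_inj.
have -> : [exists k : 'I_n, [&& (i < k)%N, (k < j)%N & (p i < p k)%N]] =
    has (fun k => (i < k) && (p i < nth 0 (map val (perm_seq p)) k))%N (iota 0 j).
  apply/existsP/hasP => [[k /and3P[ik kj pk]]|[k]].
    by exists (k : nat); rewrite ?mem_iota // ik nth_perm_seq.
  rewrite mem_iota /= add0n => kj /andP[ik pk].
  have ltk : (k < n)%N := ltn_trans kj (ltn_ord j).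
  by exists (Ordinal ltk); rewrite ik kj -(nth_perm_seq p (Ordinal ltk)).
by [].
Qed.

Lemma prw_perm_seq n (p : 'S_n.+1) : sprw 0 (map val (perm_seq p)) = (p \in PRW n.+1).
Proof.
have nthP := nth_perm_seq p.
have ascE (i : 'I_n.+1) (lti : (i.+1 < n.+1)%N) : ascent p i = (p i < p (Ordinal lti))%N.
  apply/existsP/idP => [[j /andP[/eqP Ej]]|lt]; last by exists (Ordinal lti); rewrite eqxx.
  by rewrite (_ : j = Ordinal lti) //; apply: val_inj.
rewrite inE; apply/sprwP/forallP => H.
  move=> i; apply/implyP => /andP[asc /forallP noasc].
  have lti : (i.+1 < n.+1)%N by case/existsP: asc => j /andP[/eqP <-].
  rewrite -nthP; apply/eqP; apply: H; rewrite ?size_perm_seq //.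
    by move: asc; rewrite (ascE i lti) nthP (nthP (Ordinal lti)).
  move=> j ltji; have ltj : (j < n.+1)%N by apply: ltn_trans ltji _.
  have ltj1 : (j.+1 < n.+1)%N by apply: leq_ltn_trans ltji _.
  have := noasc (Ordinal ltj); rewrite /= ltji /= (ascE (Ordinal ltj) ltj1) -leqNgt.
  by rewrite (nthP (Ordinal ltj1)) (nthP (Ordinal ltj)).
move=> i; rewrite size_perm_seq => lti lt noasc.
pose i' := Ordinal (ltnW lti).
have /implyP := H i'; rewrite (nthP i'); move=> Hi; apply/eqP; apply: Hi.
rewrite /first_ascent (ascE i' lti) -(nthP i') -(nthP (Ordinal lti)) lt /=.
apply/forallP => j; apply/implyP => ltji.
have ltj1 : (j.+1 < n.+1)%N by apply: leq_ltn_trans ltji _; apply: ltnW.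
rewrite (ascE j ltj1) -leqNgt -(nthP j) -(nthP (Ordinal ltj1)); exact: noasc.
Qed.

(** * Words counted by descents, ascents and plateaus *)

Section Words.
Variables (R : comNzRingType) (t : R).

(* An ascent weighs [t], a descent [1] and a plateau [1 + t]. *)
Definition adj (v u : nat) : R := (u <= v)%N%:R + t * (v <= u)%N%:R.

Section Alphabet.
Variables (y : nat -> R) (r : nat).

(** Total weight of the words of length [n] with first letter [v] and all later letters in [a,
    r). *)
Fixpoint word_from (a n v : nat) : R :=
  if n is n'.+1 then
    y v * ((n' == 0%N)%:R + \sum_(u < r | (a <= u)%N) adj v u * word_from a n' u)
  else 0.

Definition word_sum (a n : nat) : R :=
  (n == 0%N)%:R + \sum_(v < r | (a <= v)%N) word_from a n v.

Lemma word_fromS a n v : word_from a n.+1 v =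
  y v * ((n == 0%N)%:R + \sum_(u < r | (a <= u)%N) adj v u * word_from a n u).
Proof. by []. Qed.

Lemma big_letters1 a (F : nat -> R) : (a < r)%N ->
  \sum_(v < r | (a <= v)%N) F v = F a + \sum_(v < r | (a < v)%N) F v.
Proof.
move=> lt_ar; rewrite (bigD1 (Ordinal lt_ar)) //=; congr (_ + _).
by apply: eq_bigl => v; rewrite -val_eqE /= ltn_neqAle eq_sym andbC.
Qed.

(* Both [word_from a] on the letters above [a] and the closed walks of
   [walk_sum] below satisfy this linear recursion, so both factor through the
   words avoiding [a]. *)
Lemma linear_word_from a (g : nat -> R) (F : nat -> nat -> R) :
  (forall v, (a < v < r)%N -> F 0 v = 0) ->
  (forall n v, (a < v < r)%N ->
     F n.+1 v = y v * (g n + \sum_(u < r | (a < u)%N) adj v u * F n u)) ->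
  forall n v, (a < v < r)%N -> F n v = \sum_(k < n.+1) g k * word_from a.+1 (n - k) v.
Proof.
move=> F0 FS n; elim: n => [|n IH] v lt_v.
  by rewrite F0 // big_ord_recl big_ord0 /= mulr0 addr0.
rewrite FS // big_ord_recr /= subnn mulr0 addr0.
rewrite (eq_bigr (fun u : 'I_r => \sum_(k < n.+1) g k * (adj v u * word_from a.+1 (n - k) u)));
  last first.
  move=> u ltu; rewrite IH ?ltu ?ltn_ord // mulr_sumr; apply: eq_bigr => k _; ring.
rewrite exchange_big /= [X in X + _](_ : g n = \sum_(k < n.+1) g k * ((n - k)%N == 0%N)%:R).
  rewrite -big_split mulr_sumr; apply: eq_bigr => k _ /=.
  rewrite subSn; last by rewrite -ltnS.
  by rewrite word_fromS -mulr_sumr; ring.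
rewrite big_ord_recr /= subnn mulr1 big1 ?add0r // => k _.
by rewrite subn_eq0 leqNgt ltn_ord mulr0.
Qed.

Lemma sum_linear_word_from a (g : nat -> R) (F : nat -> nat -> R) :
  (forall v, (a < v < r)%N -> F 0 v = 0) ->
  (forall n v, (a < v < r)%N ->
     F n.+1 v = y v * (g n + \sum_(u < r | (a < u)%N) adj v u * F n u)) ->
  forall n, g n + \sum_(v < r | (a < v)%N) F n v = \sum_(k < n.+1) g k * word_sum a.+1 (n - k).
Proof.
move=> F0 FS n.
rewrite (eq_bigr (fun v : 'I_r => \sum_(k < n.+1) g k * word_from a.+1 (n - k) v)); last first.
  by move=> v ltv; rewrite (linear_word_from F0 FS) // ltv ltn_ord.
rewrite exchange_big /= [X in X + _](_ : g n = \sum_(k < n.+1) g k * ((n - k)%N == 0%N)%:R).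
  rewrite -big_split; apply: eq_bigr => k _ /=.
  by rewrite /word_sum mulrDr mulr_sumr.
rewrite big_ord_recr /= subnn mulr1 big1 ?add0r // => k _.
by rewrite subn_eq0 leqNgt ltn_ord mulr0.
Qed.

Lemma word_sum0 a : word_sum a 0 = 1.
Proof. by rewrite /word_sum big1 ?addr0. Qed.

Lemma word_sum_geq a n : (r <= a)%N -> word_sum a n = (n == 0%N)%:R.
Proof.
move=> le_ra; rewrite /word_sum big_pred0 ?addr0 // => v.
by apply/negbTE; rewrite -ltnNge (leq_trans (ltn_ord v)).
Qed.

(** A word is cut before its first letter [a]. The step down to [a] has weight 1, so the weight is
    the product of the weights of both parts. *)
Lemma word_sumS a n : (a < r)%N ->
  word_sum a n.+1 = word_sum a.+1 n.+1 + y a * (word_sum a n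
    + t * (\sum_(k < n.+1) word_sum a k * word_sum a.+1 (n - k)) - t * word_sum a.+1 n).
Proof.
(* [kap n] weighs the words of length [n] that are empty or begin with [a]; [kapS] deletes this
   leading [a]. *)
move=> lt_ar; pose kap n := (n == 0%N)%:R + word_from a n a.
have adj_lt v : (a < v)%N -> adj v a = 1.
  by move=> lt; rewrite /adj (ltnW lt) leqNgt lt mulr0 addr0.
have F0 v : (a < v < r)%N -> word_from a 0 v = 0 by [].
have FS m v : (a < v < r)%N -> word_from a m.+1 v =
    y v * (kap m + \sum_(u < r | (a < u)%N) adj v u * word_from a m u).
  case/andP=> ltv _; rewrite word_fromS (big_letters1 (fun u => adj v u * word_from a m u)) //.
  by rewrite adj_lt // mul1r addrA.
have WE m : word_sum a m = \sum_(k < m.+1) kap k * word_sum a.+1 (m - k).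
  rewrite -(sum_linear_word_from F0 FS) /word_sum.
  by rewrite (big_letters1 (word_from a m)) // addrA.
have kapS m : kap m.+1 = y a * (kap m + t * word_sum a m - t * (m == 0%N)%:R).
  rewrite /kap [word_from a m.+1 a]word_fromS add0r.
  rewrite (big_letters1 (fun u => adj a u * word_from a m u)) //.
  rewrite /word_sum (big_letters1 (word_from a m)) //.
  have -> : \sum_(v < r | (a < v)%N) adj a v * word_from a m v =
      t * \sum_(v < r | (a < v)%N) word_from a m v.
    rewrite mulr_sumr; apply: eq_bigr => v ltv.
    by rewrite /adj leqNgt ltv (ltnW ltv) add0r mulr1.
  rewrite /adj leqnn /=; ring.
rewrite WE big_ord_recl subn0; congr (_ + _).
  by rewrite /kap /= addr0 mul1r.
rewrite (eq_bigr (fun k : 'I_n.+1 => y a * (kap k * word_sum a.+1 (n - k)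
   + t * (word_sum a k * word_sum a.+1 (n - k))
   - t * ((k == 0%N :> nat)%:R * word_sum a.+1 (n - k))))); last first.
  by move=> k _; rewrite lift0 kapS subSS; ring.
rewrite -mulr_sumr sumrB big_split -!mulr_sumr -WE /=; congr (_ * (_ - t * _)).
by rewrite big_ord_recl /= subn0 mul1r big1 ?addr0 // => k _; rewrite mul0r.
Qed.

Lemma word_sum_unique a (g : nat -> R) : (a < r)%N -> g 0 = 1 ->
  (forall n, g n.+1 = word_sum a.+1 n.+1 + y a * (g n
    + t * (\sum_(k < n.+1) g k * word_sum a.+1 (n - k)) - t * word_sum a.+1 n)) ->
  forall n, g n = word_sum a n.
Proof.
move=> lt_ar g0 gS n; elim/ltn_ind: n => -[|n] IH; first by rewrite g0 word_sum0.
rewrite gS (word_sumS n lt_ar) (IH n) //; congr (_ + _ * (_ + t * _ - _)).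
by apply: eq_bigr => k _; rewrite IH.
Qed.

End Alphabet.
End Words.

(** * Congruences modulo a ring element *)

Section Congruence.
Variables (R : comNzRingType) (c : R).

Definition eqmodr (x y : R) := exists g, x = y + c * g.

Lemma eqmodr_refl x : eqmodr x x. Proof. by exists 0; ring. Qed.

Lemma eqmodr_sym x y : eqmodr x y -> eqmodr y x.
Proof. by case=> g ->; exists (- g); ring. Qed.

Lemma eqmodr_trans y x z : eqmodr x y -> eqmodr y z -> eqmodr x z.
Proof. by case=> g -> [h ->]; exists (g + h); ring. Qed.

Lemma eqmodrD x x' y y' : eqmodr x x' -> eqmodr y y' -> eqmodr (x + y) (x' + y').
Proof. by case=> g -> [h ->]; exists (g + h); ring. Qed.

Lemma eqmodrM x x' y y' : eqmodr x x' -> eqmodr y y' -> eqmodr (x * y) (x' * y').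
Proof. by case=> g -> [h ->]; exists (x' * h + y' * g + c * g * h); ring. Qed.

Lemma eqmodr_sum (I : Type) (s : seq I) (P : pred I) (F G : I -> R) :
  (forall i, P i -> eqmodr (F i) (G i)) -> eqmodr (\sum_(i <- s | P i) F i) (\sum_(i <- s | P
    i) G i).
Proof. by move=> E; elim/big_ind2: _ => //; [exact: eqmodr_refl | move=> *; exact: eqmodrD]. Qed.

End Congruence.

(** * Words with letters weighted by powers of q *)

Section WordLimit.
Variables (R : comNzRingType) (t q : R).
Let y v := q ^+ v.

(** Raising every letter by one changes no comparison of letters and multiplies the weight by [q]
    per letter. *)
Lemma word_from_shift r a n v :
  word_from t y r.+1 a.+1 n v.+1 = q ^+ n * word_from t y r a n v.
Proof.
elim: n v => [|n IH] v; first by rewrite mulr0.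
rewrite !word_fromS big_mkcond big_ord_recl /= add0r.
rewrite [X in _ = _ * (_ * (_ + X))]big_mkcond /=.
rewrite (_ : \sum_(i < r) _ = q ^+ n * \sum_(u < r)
   (if (a <= u)%N then adj t v u * word_from t y r a n u else 0)); last first.
  rewrite mulr_sumr; apply: eq_bigr => u _; rewrite /bump /= add1n ltnS.
  by case: ifP => _; rewrite ?mulr0 // IH /adj !ltnS; ring.
rewrite /y !exprS; case: n {IH} => [|n] /=; rewrite ?expr0; ring.
Qed.

Lemma word_sum_shift r a n :
  word_sum t y r.+1 a.+1 n = q ^+ n * word_sum t y r a n.
Proof.
rewrite /word_sum mulrDr; congr (_ + _).
  by case: n => [|n] /=; rewrite ?mulr0 // mulr1.
rewrite big_mkcond big_ord_recl /= add0r [in RHS]big_mkcond mulr_sumr.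
apply: eq_bigr => u _; rewrite /bump /= add1n ltnS.
by case: ifP => _; rewrite ?mulr0 // word_from_shift.
Qed.

(** A word that uses the additional letter [r] has a factor q^r in its weight. *)
Lemma word_from_stable r n v :
  eqmodr (q ^+ r) (word_from t y r.+1 0 n v) (word_from t y r 0 n v).
Proof.
elim: n v => [|n IH] v; first exact: eqmodr_refl.
rewrite !word_fromS; apply: eqmodrM; first exact: eqmodr_refl.
apply: eqmodrD; first exact: eqmodr_refl.
rewrite big_ord_recr /= -[X in eqmodr _ _ X]addr0; apply: eqmodrD.
  by apply: eqmodr_sum => u _; apply: eqmodrM; [exact: eqmodr_refl | exact: IH].
case: n {IH} => [|n]; first by rewrite mulr0; exact: eqmodr_refl.
by rewrite word_fromS /y; eexists; rewrite add0r mulrCA.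
Qed.

Lemma word_sum_stable r n :
  eqmodr (q ^+ r) (word_sum t y r.+1 0 n) (word_sum t y r 0 n).
Proof.
apply: eqmodrD; first exact: eqmodr_refl.
rewrite big_ord_recr /= -[X in eqmodr _ _ X]addr0; apply: eqmodrD.
  by apply: eqmodr_sum => u _; exact: word_from_stable.
case: n => [|n]; first exact: eqmodr_refl.
by rewrite word_fromS /y; eexists; rewrite add0r.
Qed.

Lemma word_sum_qEul r n :
  eqmodr (q ^+ r) (qfact q n * word_sum t y r.+1 0 n) (qEul t q n).
Proof.
elim/ltn_ind: n => -[|n] IH.
  by rewrite qfact0 word_sum0 mul1r; exact: eqmodr_refl.
set W := word_sum t y r.+1 0.
(* This is [word_sumS] at the letter 0: the letters above 0 are a shifted alphabet of [r] letters,
   which modulo q^r is as good as one of [r + 1]. The term q^(n+1) W_(n+1) moves to the left. *)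
have E1 : eqmodr (q ^+ r) ((1 - q ^+ n.+1) * W n.+1)
    (W n + t * (\sum_(k < n.+1) W k * (q ^+ (n - k) * W (n - k)%N)) - t * (q ^+ n * W n)).
  have Wstab m : eqmodr (q ^+ r) (q ^+ m * word_sum t y r 0 m) (q ^+ m * W m).
    by apply: eqmodrM; [exact: eqmodr_refl | apply/eqmodr_sym/word_sum_stable].
  rewrite mulrBl mul1r {1}/W word_sumS // -/W /y expr0 mul1r !word_sum_shift.
  rewrite -[X in eqmodr _ _ X]add0r -addrAC; apply: eqmodrD.
    have [g Eg] := Wstab n.+1; rewrite Eg; exists g; ring.
  rewrite -!mulNr; apply: eqmodrD; last by apply: eqmodrM; [exact: eqmodr_refl | exact: Wstab].
  apply: eqmodrD; first exact: eqmodr_refl.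
  apply: eqmodrM; first exact: eqmodr_refl.
  apply: eqmodr_sum => k _; apply: eqmodrM; first exact: eqmodr_refl.
  by rewrite word_sum_shift; exact: Wstab.
rewrite qfactS -mulrA.
apply: (eqmodr_trans (eqmodrM (eqmodr_refl _ (qfact q n)) E1)).
rewrite qEulS.
have -> : qfact q n * (W n + t * (\sum_(k < n.+1) W k * (q ^+ (n - k) * W (n - k)%N)) - t * (q
  ^+ n * W n)) =
   (1 - t * q ^+ n) * (qfact q n * W n) + t * (\sum_(k < n.+1) gbin q n k * (qfact q k * W k)
     * (q ^+ (n - k) * (qfact q (n - k) * W (n - k)%N))).
  have -> : \sum_(k < n.+1) gbin q n k * (qfact q k * W k) * (q ^+ (n - k) * (qfact q (n - k) *
    W (n - k)%N))
     = qfact q n * (\sum_(k < n.+1) W k * (q ^+ (n - k) * W (n - k)%N)).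
    rewrite mulr_sumr; apply: eq_bigr => k _.
    have le_kn : (k <= n)%N by rewrite -ltnS.
    have := gbin_fact q k (n - k); rewrite subnKC // => <-; ring.
  ring.
apply: eqmodrD; first by apply: eqmodrM; [exact: eqmodr_refl | exact: IH].
apply: eqmodrM; first exact: eqmodr_refl.
apply: eqmodr_sum => k _; apply: eqmodrM.
  by apply: eqmodrM; [exact: eqmodr_refl | exact: IH].
by apply: eqmodrM; [exact: eqmodr_refl | apply: IH; rewrite ltnS leq_subr].
Qed.
End WordLimit.

(** * Standardization of labelled words *)

Lemma card_ord_lt n (i : 'I_n) : #|[set j : 'I_n | (j < i)%N]| = i.
Proof.
rewrite -sum1_card (eq_bigl (fun j : 'I_n => (j < i)%N)) => [|j]; last by rewrite inE.
by rewrite -(big_ord_widen n (fun=> 1%N)) ?sum1_card ?card_ord // ltnW.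
Qed.

Lemma down_closed_card n (P : pred 'I_n) :
  (forall i j : 'I_n, (j <= i)%N -> P i -> P j) -> forall i : 'I_n, P i = (i < #|P|)%N.
Proof.
move=> closed i; apply/idP/idP => [Pi|]; last first.
  apply: contraLR => nPi; rewrite -leqNgt -[X in (_ <= X)%N]card_ord_lt; apply: subset_leq_card.
  apply/subsetP => j Pj; rewrite inE ltnNge; apply: contra nPi => /closed; exact.
rewrite -{1}(card_ord_lt i); apply: proper_card; apply/properP.
split; last by exists i; rewrite ?inE ?ltnn.
by apply/subsetP => j; rewrite inE => /ltnW /closed; apply.
Qed.

Lemma cardsU_disjoint (T : finType) (A B : {set T}) :
  (forall x, x \in A -> x \notin B) -> (#|A| + #|B|)%N = #|A :|: B|.
Proof.
move=> dis; rewrite -cardsUI (_ : A :&: B = set0) ?cards0 ?addn0 //.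
by apply/setP => x; rewrite !inE; case: (boolP (x \in A)) => // /dis/negbTE.
Qed.

Section Standardization.
Variables (r n : nat).
Implicit Types (s : {ffun 'I_n -> 'I_r}) (w : {ffun 'I_n -> 'I_r * bool}) (p : 'S_n).

(* Decreasing letters, excedances first, then increasing positions. *)
Definition key_lt (a b : ('I_r * bool) * 'I_n) : bool :=
  (b.1.1 < a.1.1)%N || (a.1.1 == b.1.1) &&
    ((a.1.2 && ~~ b.1.2) || (a.1.2 == b.1.2) && (a.2 < b.2)%N).

Lemma key_lt_irr a : key_lt a a = false.
Proof. by rewrite /key_lt !ltnn !eqxx andbN. Qed.

Lemma key_lt_trans : transitive key_lt.
Proof.
case=> [[u b] k] [[u' b'] k'] [[u'' b''] k'']; rewrite /key_lt /= -!val_eqE /=.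
by case: b; case: b'; case: b''; lia.
Qed.

Lemma key_lt_total a b : a.2 != b.2 -> key_lt a b || key_lt b a.
Proof.
case: a b => [[u b] k] [[u' b'] k']; rewrite /key_lt /= -!val_eqE /=.
by case: b; case: b'; lia.
Qed.

Definition ranked w k := (w k, k).

Definition rank_set w k := [set k' | key_lt (ranked w k') (ranked w k)].

Lemma key_lt_rank w k k' : key_lt (ranked w k) (ranked w k') = (#|rank_set w k| < #|rank_set w
  k'|)%N.
Proof.
have mono l l' : key_lt (ranked w l) (ranked w l') -> (#|rank_set w l| < #|rank_set w l'|)%N.
  move=> lt; apply: proper_card; apply/properP; split.
    by apply/subsetP => j; rewrite !inE => /key_lt_trans; apply.
  by exists l; rewrite !inE ?lt ?key_lt_irr.
apply/idP/idP => [/mono //|]; case: (eqVneq k k') => [->|neq]; first by rewrite ltnn.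
have /orP[//|/mono lt'] := key_lt_total (a := ranked w k) (b := ranked w k') neq.
by move/(ltn_trans lt'); rewrite ltnn.
Qed.

Lemma rank_lt w k : (#|rank_set w k| < n)%N.
Proof.
rewrite -[X in (_ < X)%N](card_ord n); apply: proper_card; apply/properP; split.
  exact/subsetP.
by exists k; rewrite // inE key_lt_irr.
Qed.

Definition rank w k := Ordinal (rank_lt w k).

Lemma rank_inj w : injective (rank w).
Proof.
move=> k k' E; apply/eqP; apply: contraT => neq.
have := key_lt_total (a := ranked w k) (b := ranked w k') neq.
by rewrite !key_lt_rank; move/(congr1 val): E => /= ->; rewrite ltnn.
Qed.

(** Its one-line notation lists the indices [k] in the order of the keys [(w k, k)]. *)
Definition sort_perm w : 'S_n := ((perm (@rank_inj w))^-1)%g.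

Lemma sort_permK w k : sort_perm w (rank w k) = k.
Proof. by rewrite /sort_perm -[rank w k](permE (@rank_inj w)) permK. Qed.

Lemma rank_sort_perm w i : rank w (sort_perm w i) = i.
Proof. by rewrite -[RHS](permKV (perm (@rank_inj w))) [RHS]permE. Qed.

Lemma key_lt_sort w i j :
  key_lt (ranked w (sort_perm w i)) (ranked w (sort_perm w j)) = (i < j)%N.
Proof.
rewrite key_lt_rank -[#|rank_set w (sort_perm w i)|]/(val (rank w (sort_perm w i))).
by rewrite -[#|rank_set w (sort_perm w j)|]/(val (rank w (sort_perm w j))) !rank_sort_perm.
Qed.

(** Inverse to [sort_perm] on the permutations compatible with [s], by [sort_label] and
    [sort_compatible]. Labels are indexed by the values of [p], not by its positions. *)
Definition label s p : {ffun 'I_n -> 'I_r * bool} :=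
  [ffun k => (s ((p^-1)%g k), (((p^-1)%g k < k)%N))].

Definition compatible s p := [forall i : 'I_n, forall j : 'I_n,
  (i < j)%N ==> key_lt (s i, (i < p i)%N, p i) (s j, (j < p j)%N, p j)].

Lemma labelE s p i : ranked (label s p) (p i) = (s i, (i < p i)%N, p i).
Proof. by rewrite /ranked /label ffunE permK. Qed.

Lemma compatibleP s p :
  reflect (forall i j : 'I_n, (i < j)%N = key_lt (ranked (label s p) (p i)) (ranked (label s p)
    (p j)))
    (compatible s p).
Proof.
apply: (iffP forallP) => H.
  have mono (i j : 'I_n) : (i < j)%N -> key_lt (ranked (label s p) (p i)) (ranked (label s p)
    (p j)).
    by rewrite !labelE; move: i j => i j; move/forallP: (H i) => /(_ j)/implyP.
  move=> i j; case: (ltngtP i j) => [/mono -> //|/mono lt|/val_inj ->];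
    last by rewrite key_lt_irr.
  by apply/esym/negP => /(key_lt_trans lt); rewrite key_lt_irr.
by move=> i; apply/forallP => j; apply/implyP; rewrite H !labelE.
Qed.

Lemma sort_label s p : compatible s p -> sort_perm (label s p) = p.
Proof.
move/compatibleP => H; apply/permP => i; rewrite -[RHS](sort_permK (label s p));
  congr (sort_perm _ _).
apply: val_inj; rewrite /= -[LHS]card_ord_lt -(card_imset _ (@perm_inj _ p)).
apply: eq_card => k; rewrite inE; apply/imsetP/idP => [[j]|].
  by rewrite inE H => lt ->.
by move=> lt; exists ((p^-1)%g k); rewrite ?permKV // inE H permKV.
Qed.

Definition first_in_block s (k : 'I_n) := [forall j : 'I_n, (j < k)%N ==> (s j != s k)].

(* The positions and the ranks of a letter equal to [s k] fill the same interval,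
   so a letter marked as excedance at the first of these positions would have its
   own position as rank. *)
Definition letter_ok s (k : 'I_n) (a : 'I_r * bool) : bool :=
  if (s k < a.1)%N then a.2 else if (a.1 < s k)%N then ~~ a.2
  else ~~ (a.2 && first_in_block s k).

Definition weakly_decreasing s := [forall i : 'I_n, forall j : 'I_n, (i <= j)%N ==> (s j <= s
  i)%N].

Definition same_content s w := [forall v : 'I_r, #|[set k | (w k).1 == v]| == #|[set k | s k ==
  v]|].

Lemma weakly_decreasingP s :
  reflect (forall i j : 'I_n, (i <= j)%N -> (s j <= s i)%N) (weakly_decreasing s).
Proof.
apply: (iffP forallP) => H i; last by apply/forallP => j; apply/implyP/H.
by move=> j; move/forallP: (H i) => /(_ j)/implyP.
Qed.

Lemma same_content_card s w (P : pred 'I_r) : same_content s w ->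
  #|[set k | P (w k).1]| = #|[set k | P (s k)]|.
Proof.
move/forallP => H.
have E (f : 'I_n -> 'I_r) : #|[set k | P (f k)]| = (\sum_(v | P v) #|[set k | f k == v]|)%N.
  rewrite -sum1_card (partition_big f P) => [|k]; last by rewrite inE.
  apply: eq_bigr => v Pv; rewrite -sum1_card; apply: eq_bigl => k; rewrite !inE.
  by case: eqVneq => [->|]; rewrite ?Pv ?andbF.
by rewrite (E (fun k => (w k).1)) E; apply: eq_bigr => v _; apply/eqP.
Qed.

Lemma compatible_decreasing s p : compatible s p -> weakly_decreasing s.
Proof.
move/forallP => H; apply/weakly_decreasingP => i j.
rewrite leq_eqVlt => /predU1P[/val_inj -> //|ltij].
have /forallP/(_ j)/implyP/(_ ltij) := H i.
by rewrite /key_lt /= => /orP[/ltnW//|/andP[/eqP -> _]].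
Qed.

(** Let [i] be the position of the value [k]. If [s i] and [s k] differ, monotonicity of [s] decides
    whether [i < k]; if they agree and [i < k], then [k] is not first in its block. *)
Lemma label_ok s p : compatible s p ->
  same_content s (label s p) /\ forall k, letter_ok s k (label s p k).
Proof.
move=> comp; have dec := weakly_decreasingP _ (compatible_decreasing comp); split.
  apply/forallP => v; apply/eqP; rewrite -[RHS](card_imset _ (@perm_inj _ p));
    apply: eq_card => k.
  rewrite inE ffunE /=; apply/idP/imsetP => [sk|[j]].
    by exists ((p^-1)%g k); rewrite ?permKV ?inE.
  by rewrite inE => sj ->; rewrite permK.
move=> k; rewrite /letter_ok ffunE /=; set i := (p^-1)%g k.
case: ifP => [lt|nlt]; first by rewrite ltnNge; apply: contraL lt => /dec; rewrite -leqNgt.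
case: ifP => [lt|_]; first by apply: contraL lt => /ltnW/dec; rewrite -leqNgt.
apply/andP => -[ltik /forallP/(_ i)/implyP/(_ ltik)/negP]; apply.
by have := dec _ _ (ltnW ltik); rewrite leq_eqVlt nlt orbF => /eqP Es; apply/eqP/val_inj.
Qed.

(** Both sides decrease weakly in [i], so the positions with letters at least [v] form an initial
    segment; its length depends on the content alone. *)
Lemma sorted_label s w : weakly_decreasing s -> same_content s w ->
  forall i, (w (sort_perm w i)).1 = s i.
Proof.
move=> /weakly_decreasingP dec cont i; pose p := sort_perm w.
have geE (v : nat) : (v <= s i)%N = (v <= (w (p i)).1)%N.
  rewrite (down_closed_card (P := fun j => v <= s j)%N); last first.
    by move=> j k le_kj; move/leq_trans; apply; apply: dec.
  rewrite [RHS](down_closed_card (P := fun j => v <= (w (p j)).1)%N); last first.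
    move=> j k; rewrite leq_eqVlt => /predU1P[/val_inj -> //|].
    rewrite -(key_lt_sort w) /key_lt /= => /orP[/ltnW lt|/andP[/eqP -> _] //].
    by move/leq_trans; apply.
  congr (_ < _)%N; have := same_content_card (fun u : 'I_r => v <= u)%N cont.
  rewrite -(card_imset _ (@perm_inj _ (p^-1)%g)) => E.
  transitivity #|[set k | (v <= s k)%N]|; first by apply: eq_card => k; rewrite inE.
  rewrite -E; apply: eq_card => k; rewrite [RHS]unfold_in /=; apply/imsetP/idP => [[j]|lt].
    by rewrite inE => lt ->; rewrite permKV.
  by exists (p k); rewrite ?permK // inE.
apply: val_inj; apply/eqP; rewrite eqn_leq -/p.
by rewrite -geE leqnn geE leqnn.
Qed.

(** Monotonicity of [s] settles the case where the letters of [w k] and [s k] differ. Otherwise the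
    elements before [k], or those not before it, are counted. *)
Lemma sorted_excedance s w : weakly_decreasing s -> same_content s w ->
  (forall k, letter_ok s k (w k)) -> forall k, (rank w k < k)%N = (w k).2.
Proof.
move=> decs cont ok k; have dec := weakly_decreasingP _ decs.
have sr : s (rank w k) = (w k).1 by rewrite -(sorted_label decs cont) sort_permK.
have := ok k; rewrite /letter_ok; case: ifP => [lt ->|nlt].
  by rewrite ltnNge; apply: contraL lt => /dec; rewrite sr -leqNgt.
case: ifP => [lt /negbTE ->|nlt'].
  by apply: contraTF lt => /ltnW/dec; rewrite sr -leqNgt.
have {nlt nlt'} Ek : (w k).1 = s k by apply: val_inj; move: nlt nlt'; case: ltngtP.
have same k' : letter_ok s k' (w k') -> (w k').1 = s k ->
    if (w k').2 then (s k' <= s k)%N else (s k <= s k')%N.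
  rewrite /letter_ok => + E; rewrite E; case: ltngtP => //; case: (w k').2 => //.
move Eb : (w k).2 => [] /=.
  move=> nfirst; have [f ltfk /andP[sf firstf]] :
      exists2 f : 'I_n, (f < k)%N & (s f == s k) && first_in_block s f.
    have /existsP[j0] : [exists j : 'I_n, (j < k)%N && (s j == s k)].
      move: nfirst; rewrite /first_in_block negb_forall => /existsP[j].
      by rewrite negb_imply negbK => jP; apply/existsP; exists j.
    case/(@arg_minnP _ j0 (fun j : 'I_n => (j < k)%N && (s j == s k)) (fun j => j : nat)) => f
      /andP[ltfk sf] minf.
    exists f => //; rewrite sf /=; apply/forallP => j; apply/implyP => ltjf.
    rewrite (eqP sf); apply/negP => sj; have := minf j; rewrite sj (ltn_trans ltjf ltfk).
    by move/(_ isT); rewrite leqNgt ltjf.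
  (* The rank of a marked [k] is [#|S1| + #|S2|]. Both sets lie below [k] and miss the first
     position [f] of the block, which [letter_ok] forbids to be marked; hence the rank is less than
     [k]. *)
  pose S1 := [set j | (s k < s j)%N].
  pose S2 := [set k' : 'I_n | ((w k').1 == s k) && (w k').2 && (k' < k)%N].
  have -> : #|rank_set w k| = (#|S1| + #|S2|)%N.
    rewrite -(same_content_card (fun v => s k < v)%N cont) cardsU_disjoint.
      apply: eq_card => k'; rewrite !inE /key_lt /= Ek Eb andbF /=.
      by case: (w k').2; rewrite ?andbF ?andbT.
    by move=> k'; rewrite !inE; case: eqVneq => [->|]; rewrite ?ltnn.
  have s2 k' : k' \in S2 -> s k' = s k.
    rewrite inE => /andP[/andP[/eqP E b] lt]; have := same k' (ok k') E; rewrite b => le.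
    by apply: val_inj; apply/eqP; rewrite eqn_leq le; apply: dec; apply: ltnW.
  rewrite -[X in (_ < X)%N](card_ord_lt k) cardsU_disjoint.
    apply: proper_card; apply/properP; split.
      apply/subsetP => j; rewrite in_setU => /orP[|]; rewrite !inE; last by case/andP.
      by move=> lt; rewrite ltnNge; apply: contraL lt => /dec; rewrite -leqNgt.
    exists f; first by rewrite inE.
    rewrite !inE (eqP sf) ltnn /=; apply/negP => /andP[/andP[/eqP E b] _].
    by have := ok f; rewrite /letter_ok E (eqP sf) ltnn b firstf.
  by move=> k'; rewrite inE => lt; apply/negP => /s2 E; rewrite E ltnn in lt.
move=> _; apply/negbTE; rewrite -leqNgt.
(* For an unmarked [k], [#|S1| + #|S2|] counts the elements not before [k], including [k]. Both sets
   lie in the positions from [k] on, so the rank is at least [k]. *)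
pose S1 := [set j | (s j < s k)%N].
pose S2 := [set k' : 'I_n | ((w k').1 == s k) && ~~ (w k').2 && (k <= k')%N].
have cE : #|~: rank_set w k| = (#|S1| + #|S2|)%N.
  rewrite -(same_content_card (fun v => v < s k)%N cont) cardsU_disjoint.
    apply: eq_card => k'; rewrite !inE /key_lt /= Ek Eb andbT -val_eqE /=.
    by case: ltngtP => //= _; case: (w k').2; rewrite //= -leqNgt.
  by move=> k'; rewrite !inE; case: eqVneq => [->|]; rewrite ?ltnn.
have s2 k' : k' \in S2 -> s k' = s k.
  rewrite inE => /andP[/andP[/eqP E /negbTE b] lt]; have := same k' (ok k') E; rewrite b => le.
  by apply: val_inj; apply/eqP; rewrite eqn_leq le dec.
have : (#|S1| + #|S2| <= #|~: [set j : 'I_n | (j < k)%N]|)%N.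
  rewrite cardsU_disjoint.
    apply: subset_leq_card; apply/subsetP => j.
    rewrite in_setU => /orP[|]; rewrite !inE -leqNgt; last by case/andP.
    by move=> lt; rewrite leqNgt; apply: contraL lt => /ltnW/dec; rewrite -leqNgt.
  by move=> k'; rewrite inE => lt; apply/negP => /s2 E; rewrite E ltnn in lt.
rewrite -cE; have := cardsC (rank_set w k); have := cardsC [set j : 'I_n | (j < k)%N].
rewrite card_ord_lt => E1 E2 le.
by rewrite -(leq_add2r #|~: rank_set w k|) E2 -E1 leq_add2l.
Qed.

Lemma sort_compatible s w : weakly_decreasing s -> same_content s w ->
  (forall k, letter_ok s k (w k)) -> label s (sort_perm w) = w /\ compatible s (sort_perm w).
Proof.
move=> dec cont ok.
have E : label s (sort_perm w) = w.
  apply/ffunP => k; rewrite ffunE.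
  have -> : ((sort_perm w)^-1)%g k = rank w k by rewrite -{1}(sort_permK w k) permK.
  rewrite (sorted_excedance dec cont ok) -(sorted_label dec cont) sort_permK.
  by case: (w k).
split=> //; apply/compatibleP => i j; by rewrite E key_lt_sort.
Qed.

(** Standardization as a change of variables; the marks of [w] are the excedances of [p]. *)
Lemma sum_compatible (R : comNzRingType) (t : R) s : weakly_decreasing s ->
  \sum_(p | compatible s p) t ^+ exc p =
  \sum_(w | same_content s w && [forall k, letter_ok s k (w k)]) \prod_k t ^+ (w k).2.
Proof.
move=> dec; rewrite (reindex_onto sort_perm (label s)); last by move=> p; exact: sort_label.
apply: eq_big => [w|w /andP[comp /eqP Ew]].
  apply/andP/andP => [[comp /eqP <-]|[cont /forallP ok]].
    by have [-> ok] := label_ok comp; split=> //; apply/forallP.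
  by have [-> ->] := sort_compatible dec cont ok.
rewrite prodrXr; congr (_ ^+ _); rewrite /exc -sum1_card big_mkcond /=.
move: (sort_perm w) Ew {comp} => p <-.
rewrite [RHS](reindex_inj (@perm_inj _ p)); apply: eq_bigr => i _.
by rewrite ffunE permK inE; case: ifP.
Qed.
End Standardization.

(** * Chains of letters *)

Lemma sum_geom_tail (R : comNzRingType) (x : R) (r c : nat) :
  (1 - x) * (\sum_(v < r | (c <= v)%N) x ^+ v) = if (c <= r)%N then x ^+ c - x ^+ r else 0.
Proof.
elim: r => [|r IH].
  by rewrite big_ord0 mulr0; case: c => [|c] //=; rewrite subrr.
rewrite big_mkcond big_ord_recr /= -big_mkcond mulrDr IH; case: (ltngtP c r.+1) => [||->].
- by rewrite ltnS => ->; rewrite exprS; ring.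
- by move=> lt; rewrite leqNgt (ltnW lt) /= mulr0 addr0.
by rewrite ltnn mulr0 addr0 subrr.
Qed.

Section Chains.
Variables (R : comNzRingType) (q : R) (r : nat) (eps : nat -> nat).

(** The letters are chosen from the last and smallest to the first; [b] bounds the last one and
    [eps i] is the least drop after position [i]. *)
Fixpoint chain_sum (n b : nat) : R :=
  if n is n'.+1 then \sum_(v < r | (eps n' + b <= v)%N) q ^+ v * chain_sum n' v else 1.

Definition next_part n (s : {ffun 'I_n -> 'I_r}) (b i : nat) : nat :=
  oapp (fun j => val (s j)) b (insub i.+1).

Definition chain n (s : {ffun 'I_n -> 'I_r}) (b : nat) :=
  [forall i : 'I_n, (eps i + next_part s b i <= s i)%N].

Definition ffun_rcons n (sv : {ffun 'I_n -> 'I_r} * 'I_r) : {ffun 'I_n.+1 -> 'I_r} :=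
  [ffun i => oapp sv.1 sv.2 (unlift ord_max i)].

Lemma chain_sumE n b :
  chain_sum n b = \sum_(s : {ffun 'I_n -> 'I_r} | chain s b) \prod_i q ^+ s i.
Proof.
elim: n b => [|n IH] b /=.
  rewrite (big_pred1 [ffun i => False_rect _ (notF (valP i : false))]) ?big_ord0 // => s.
  rewrite /= -[RHS]/(s == _); apply/forallP/eqP => [_|_ []//].
  by apply/ffunP => -[].
have bij : bijective (@ffun_rcons n).
  exists (fun s : {ffun 'I_n.+1 -> 'I_r} => ([ffun j : 'I_n => s (lift ord_max j)], s ord_max)).
    case=> s v; rewrite /ffun_rcons ffunE unlift_none /=; congr (_, _).
    by apply/ffunP => j; rewrite !ffunE liftK.
  move=> s; apply/ffunP => i; rewrite ffunE /=; case: unliftP => [j ->|->] //=.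
  by rewrite ffunE.
rewrite (reindex _ (onW_bij _ bij)) /=.
rewrite -(pair_big_dep xpredT (fun s v => chain (ffun_rcons (s, v)) b)
   (fun s v => \prod_i q ^+ ffun_rcons (s, v) i)) /=.
rewrite [RHS](exchange_big_dep xpredT) //= big_mkcond; apply: eq_bigr => v _ /=.
have lastE (s : {ffun 'I_n -> 'I_r}) : ffun_rcons (s, v) ord_max = v by rewrite ffunE unlift_none.
have initE (s : {ffun 'I_n -> 'I_r}) (j : 'I_n) : ffun_rcons (s, v) (lift ord_max j) = s j by
  rewrite ffunE liftK.
have wid (j : 'I_n) : widen_ord (leqnSn n) j = lift ord_max j by apply: val_inj;
  exact: esym (lift_max j).
have chainE (s : {ffun 'I_n -> 'I_r}) : chain (ffun_rcons (s, v)) b = chain s v && (eps n + b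
  <= v)%N.
  have nmax : next_part (ffun_rcons (s, v)) b n = b by rewrite /next_part insubN // -leqNgt.
  have ninit (j : 'I_n) : next_part (ffun_rcons (s, v)) b j = next_part s v j.
    rewrite /next_part; have [ltj|gej] := ltnP j.+1 n.
      rewrite (insubT (fun m => m < n)%N ltj) (insubT (fun m => m < n.+1)%N (ltnW ltj : j.+1 <
        n.+1)%N) /=.
      rewrite -(initE s (Ordinal ltj)); congr (val (ffun_rcons _ _)).
      by apply: val_inj; exact: esym (lift_max (Ordinal ltj)).
    rewrite [in RHS]insubN -?leqNgt //=.
    have Ej : j.+1 = n by apply/eqP; rewrite eqn_leq gej ltn_ord.
    rewrite (insubT (fun m => m < n.+1)%N (_ : j.+1 < n.+1)%N) /=; first by rewrite Ej.
    move=> H; rewrite -[in RHS](lastE s); congr (val (ffun_rcons _ _)).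
    by apply: val_inj; rewrite /= Ej.
  apply/forallP/andP => [H|[/forallP H Hv] i].
    split; last by have := H ord_max; rewrite lastE [nat_of_ord ord_max]/= nmax.
    by apply/forallP => j; have := H (lift ord_max j); rewrite initE lift_max ninit.
  case: (unliftP ord_max i) => [j|] ->; last by rewrite lastE /= nmax.
  by rewrite initE lift_max ninit.
case: ifP => [le|nle]; last first.
  by rewrite big_pred0 // => s; rewrite chainE nle andbF.
rewrite IH mulr_sumr; apply: eq_big => [s|s _]; first by rewrite chainE le andbT.
rewrite big_ord_recr /= lastE mulrC; congr (_ * _); apply: eq_bigr => j _.
by rewrite wid initE.
Qed.

(** Geometric sums from the last letter on. In the smallest chain [b] raises all [n] letters and a
    drop at [i] raises the first [i + 1] of them. *)
Lemma qfact_chain_sum n b :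
  eqmodr (q ^+ r) (qfact q n * chain_sum n b) (q ^+ (n * b + \sum_(i < n) i.+1 * eps i)).
Proof.
elim: n b => [|n IH] b.
  by rewrite qfact0 big_ord0 /= mulr1; exact: eqmodr_refl.
set E := \sum_(i < n) i.+1 * eps i in IH; set e := (eps n + b)%N.
rewrite qfactS big_ord_recr /= -/e -/E mulrAC.
have E1 : eqmodr (q ^+ r) (qfact q n * (\sum_(v < r | (e <= v)%N) q ^+ v * chain_sum n v))
    (q ^+ E * (\sum_(v < r | (e <= v)%N) (q ^+ n.+1) ^+ v)).
  rewrite !mulr_sumr; apply: eqmodr_sum => v _; rewrite mulrCA.
  rewrite (_ : q ^+ E * _ = q ^+ v * q ^+ (n * v + E)).
    by apply: eqmodrM; [exact: eqmodr_refl | exact: IH].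
  by rewrite -exprM -!exprD; congr (q ^+ _); lia.
rewrite mulrC; apply: (eqmodr_trans (eqmodrM (eqmodr_refl _ _) E1)).
rewrite mulrCA sum_geom_tail.
have -> : (n.+1 * b + (E + n.+1 * eps n) = E + n.+1 * e)%N by rewrite /e; lia.
rewrite exprD; apply: eqmodrM; first exact: eqmodr_refl.
(* The truncation term q^((n+1)r) is a multiple of q^r; if [e > r] the sum is empty and q^((n+1)e)
   is such a multiple. *)
rewrite -!exprM; case: leqP => [le|lt].
  exists (- q ^+ (n * r)); rewrite mulrN -exprD.
  by congr (_ - q ^+ _); lia.
exists (- q ^+ (n.+1 * e - r)); rewrite mulrN -exprD subnKC ?subrr //.
by rewrite (leq_trans (ltnW lt)) // leq_pmull.
Qed.
End Chains.

(** * Compatibility as a chain condition, and maj - exc *)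

Section MajExc.
Variables (n : nat) (p : 'S_n).

Definition pval i := nth 0%N (map val (perm_seq p)) i.

Definition is_exc i : nat := (i < pval i)%N.

Definition is_des i : nat := (i.+1 < n)%N && (pval i.+1 < pval i)%N.

(* The set DEX of Shareshian and Wachs.  The subtraction does not truncate: see
   [dexD]. *)
Definition dex i := (is_des i + is_exc i.+1 - is_exc i)%N.

Lemma pvalE (i : 'I_n) : pval i = p i. Proof. exact: nth_perm_seq. Qed.

Lemma pval_lt i : (i < n)%N -> (pval i < n)%N.
Proof. by move=> lti; rewrite (pvalE (Ordinal lti)). Qed.

Lemma pval_inj i j : (i < n)%N -> (j < n)%N -> pval i = pval j -> i = j.
Proof.
move=> lti ltj; rewrite (pvalE (Ordinal lti)) (pvalE (Ordinal ltj)).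
by move/val_inj/perm_inj/(congr1 val).
Qed.

Lemma is_exc_geq i : (n <= i)%N -> is_exc i = 0%N.
Proof. by move=> le; rewrite /is_exc /pval nth_default // size_perm_seq. Qed.

(** An excedance [i] that is not a descent makes [i + 1] an excedance, and the last position is
    never an excedance. *)
Lemma dexD i : (i < n)%N -> (dex i + is_exc i = is_des i + is_exc i.+1)%N.
Proof.
move=> lti; rewrite /dex subnK // /is_exc /is_des.
have [lt1|ge1] := ltnP i.+1 n; last by have := pval_lt lti; lia.
have := @pval_inj i i.+1 lti lt1; lia.
Qed.

Lemma dex_le1 i : (dex i <= 1)%N.
Proof. by rewrite /dex /is_des /is_exc; lia. Qed.

(** Summation by parts: the excedance terms, with weights [i + 1], telescope to [- exc p]. *)
Lemma sum_dex : (\sum_(i < n) i.+1 * dex i = maj p - exc p)%N.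
Proof.
have majE : maj p = (\sum_(i < n) i.+1 * is_des i)%N.
  rewrite /maj big_mkcond; apply: eq_bigr => i _.
  have -> : is_des i = descent p i.
    rewrite /is_des; have [lti|gei] := ltnP i.+1 n; last first.
      by rewrite (_ : descent p i = false) //; apply/existsP => -[j /andP[/eqP]];
        case: j => j /=; lia.
    rewrite (pvalE (Ordinal lti)) (pvalE i); congr nat_of_bool;
      apply/idP/existsP => [lt|[j /andP[/eqP Ej]]].
      by exists (Ordinal lti); rewrite eqxx.
    by rewrite (_ : j = Ordinal lti) //; apply: val_inj.
  by case: (descent p i); rewrite ?muln1 ?muln0.
have excE : exc p = (\sum_(i < n) is_exc i)%N.
  rewrite /exc -sum1_card big_mkcond; apply: eq_bigr => i _.
  by rewrite inE /is_exc pvalE; case: ifP.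
have shift : (\sum_(i < n) i.+1 * is_exc i.+1 = \sum_(i < n) i * is_exc i)%N.
  rewrite -(big_mkord xpredT (fun i => i.+1 * is_exc i.+1)%N) -(big_mkord xpredT (fun i => i *
    is_exc i)%N).
  case: n is_exc_geq => [|m] geq; first by rewrite !big_geq.
  rewrite big_nat_recr //= geq // muln0 addn0 big_nat_recl //.
have : (\sum_(i < n) i.+1 * dex i + \sum_(i < n) i.+1 * is_exc i =
        \sum_(i < n) i.+1 * is_des i + \sum_(i < n) i.+1 * is_exc i.+1)%N.
  by rewrite -!big_split; apply: eq_bigr => i _ /=; rewrite -!mulnDr dexD.
have -> : (\sum_(i < n) i.+1 * is_exc i = \sum_(i < n) i * is_exc i + exc p)%N.
  by rewrite excE -big_split; apply: eq_bigr => i _ /=; rewrite mulSn addnC.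
by rewrite -majE shift; lia.
Qed.

(** By transitivity of [key_lt] adjacent positions suffice, and there equal letters are allowed
    exactly when [dex i] is 0. *)
Lemma compatible_chain r (s : {ffun 'I_n -> 'I_r}) : compatible s p = chain dex s 0.
Proof.
have keyE (i : 'I_n) (lti : (i.+1 < n)%N) :
    key_lt (s i, (i < p i)%N, p i) (s (Ordinal lti), (i.+1 < p (Ordinal lti))%N, p (Ordinal lti))
    = (dex i + s (Ordinal lti) <= s i)%N.
  have := dexD (ltn_ord i); have := @pval_inj i i.+1 (ltn_ord i) lti.
  rewrite /is_des /is_exc lti /= (pvalE (Ordinal lti)) (pvalE i) /key_lt /= -val_eqE /=.
  have := dex_le1 i; move: (dex i) => d.
  case: (ltnP i (p i)) => h1; case: (ltnP i.+1 (p (Ordinal lti))) => h2 /=;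
  case: (ltnP (p i) (p (Ordinal lti))) => h3 /=; lia.
have nextE (i : 'I_n) (lti : (i.+1 < n)%N) : next_part s 0 i = s (Ordinal lti).
  by rewrite /next_part (insubT (fun m => m < n)%N lti).
apply/idP/idP => [/forallP H|/forallP H].
  apply/forallP => i; have [lti|gei] := ltnP i.+1 n.
    rewrite nextE -keyE; have /forallP/(_ (Ordinal lti))/implyP := H i; apply.
    exact: ltnSn.
  rewrite /next_part insubN -?leqNgt //= addn0.
  have := dexD (ltn_ord i); rewrite (is_exc_geq gei) /is_des ltnNge gei /=; lia.
have step (i j : 'I_n) : (j = i.+1 :> nat)%N -> key_lt (s i, (i < p i)%N, p i) (s j, (j < p
  j)%N, p j).
  move=> Ej; have lti : (i.+1 < n)%N by rewrite -Ej.
  have -> : j = Ordinal lti by apply: val_inj.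
  by rewrite keyE -nextE.
apply/forallP => i; apply/forallP => j; apply/implyP.
move Em : (j - i)%N => m; elim: m j Em => [|m IH] j Em ltij; first by lia.
case: m IH Em => [|m] IH Em; first by apply: step; lia.
have ltj1 : (j.-1 < n)%N by have := ltn_ord j; lia.
apply: (key_lt_trans (y := (s (Ordinal ltj1), ((Ordinal ltj1) < p (Ordinal ltj1))%N, p (Ordinal
  ltj1)))).
  by apply: IH => /=; lia.
by apply: step => /=; lia.
Qed.

End MajExc.

(** For fixed [p] the compatible words are the chains with drops [dex p]; the exponent produced by
    [qfact_chain_sum] is [sum_dex]. *)
Lemma sum_maj_exc (R : comNzRingType) (t q : R) n r :
  eqmodr (q ^+ r) (qfact q n *
    \sum_(s : {ffun 'I_n -> 'I_r} | weakly_decreasing s)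
      (\prod_i q ^+ s i) * \sum_(p | compatible s p) t ^+ exc p)
    (\sum_(p : 'S_n) q ^+ (maj p - exc p) * t ^+ exc p).
Proof.
have -> : \sum_(s : {ffun 'I_n -> 'I_r} | weakly_decreasing s)
      (\prod_i q ^+ s i) * (\sum_(p | compatible s p) t ^+ exc p) =
    \sum_(p : 'S_n) chain_sum q r (dex p) n 0 * t ^+ exc p.
  rewrite [RHS](eq_bigr (fun p : 'S_n => \sum_(s : {ffun 'I_n -> 'I_r} | compatible s p)
     (\prod_i q ^+ s i) * t ^+ exc p)); last first.
    move=> p _; rewrite chain_sumE mulr_suml; apply: eq_bigl => s.
    by rewrite compatible_chain.
  rewrite (exchange_big_dep (@weakly_decreasing r n)) /=; last first.
    by move=> p s _; apply: compatible_decreasing.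
  by apply: eq_bigr => s _; rewrite mulr_sumr.
rewrite mulr_sumr; apply: eqmodr_sum => p _; rewrite mulrA.
apply: eqmodrM; last exact: eqmodr_refl.
by have := qfact_chain_sum q r (dex p) n 0; rewrite muln0 add0n sum_dex.
Qed.

(** * Diagonal coefficients of products of linear forms *)

Section MonomialSums.
Variables (R : comNzRingType) (r : nat).

Definition sum_mdeg n (F : 'X_{1..r} -> R) : R :=
  \sum_(m : 'X_{1..r < n.+1} | mdeg m == n) F m.

Lemma eq_sum_mdeg n F G : (forall m, mdeg m = n -> F m = G m) -> sum_mdeg n F = sum_mdeg n G.
Proof. by move=> E; apply: eq_bigr => m /eqP/E. Qed.

Lemma sum_mdeg0 F : sum_mdeg 0 F = F 0%MM.
Proof.
rewrite /sum_mdeg (big_pred1 bm0) // => m.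
by rewrite /= bmeqP mdeg_eq0.
Qed.

Lemma sum_mdegS n v F :
  sum_mdeg n.+1 F = sum_mdeg n.+1 (fun m => (m v == 0%N)%:R * F m) +
    sum_mdeg n (fun m => F (m + U_(v))%MM).
Proof.
rewrite /sum_mdeg (bigID (fun m : 'X_{1..r < n.+2} => m v == 0%N)) /=; congr (_ + _).
  rewrite big_mkcondr; apply: eq_bigr => m _.
  by case: eqP => _; rewrite ?mul1r ?mul0r.
have ltD (m : 'X_{1..r < n.+1}) : (mdeg (m + U_(v))%MM < n.+2)%N.
  by rewrite mdegD mdeg1 addn1 ltnS bmdeg.
have ltB (m : 'X_{1..r < n.+2}) : (mdeg (m - U_(v))%MM < n.+1)%N || (m v == 0%N).
  case: (posnP (m v)) => [mv|gt0]; first by rewrite ?mv orbT.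
  have := bmdeg m; rewrite -{1}[bmnm m](submK (m := U_(v)%MM)).
    by rewrite mdegD mdeg1 addn1 ltnS => ->.
  by apply/mnm_lepP => i; rewrite mnm1E; case: eqP => [<-|].
rewrite (reindex_onto (fun m : 'X_{1..r < n.+1} => BMultinom (ltD m))
   (fun m : 'X_{1..r < n.+2} => insubd bm0 (m - U_(v))%MM)) /=; last first.
  move=> m /andP[_ nz]; apply/eqP; rewrite bmeqP /=.
  rewrite insubdK ?submK //.
    by apply/mnm_lepP => i; rewrite mnm1E; case: (eqVneq v i) => [<-|//]; rewrite lt0n.
  by have := ltB m; rewrite (negbTE nz) orbF.
apply: eq_bigl => m; rewrite mdegD mdeg1 addn1 eqSS mnmDE mnm1E eqxx addn1 /= andbT.
by case: eqP => //= _; rewrite bmeqP /= addmK insubdK ?eqxx //; apply: (bmdeg m).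
Qed.

Lemma sum_mdegD n F G : sum_mdeg n (fun m => F m + G m) = sum_mdeg n F + sum_mdeg n G.
Proof. exact: big_split. Qed.

Lemma sum_mdegZ n a F : sum_mdeg n (fun m => a * F m) = a * sum_mdeg n F.
Proof. by rewrite /sum_mdeg mulr_sumr. Qed.

End MonomialSums.

Section Master.
Variables (R : comNzRingType) (t : R) (y : nat -> R) (r : nat).
Implicit Types (m : 'X_{1..r}) (a u v : 'I_r).

Definition row_form v : {mpoly R[r]} := \sum_(u < r) adj t v u *: 'X_u.

(* The factor [row_form v - t *: 'X_v] stands for the first letter of the block of
   [v], which is not an excedance inside that block. *)
Definition row_prod m : {mpoly R[r]} :=
  \prod_(v < r) (if m v is k.+1 then row_form v ^+ k * (row_form v - t *: 'X_v) else 1).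

Definition ymon m : R := \prod_(v < r) y v ^+ m v.

Definition above (b : nat) m := [forall v : 'I_r, (v < b)%N ==> (m v == 0%N)].

Lemma row_prodS m v : row_prod (m + U_(v)) =
  row_prod m * (row_form v - (m v == 0%N)%:R *: (t *: 'X_v)).
Proof.
rewrite /row_prod (bigD1 v) //= [in RHS](bigD1 v) //= mnmDE mnm1E eqxx addn1.
rewrite (eq_bigr (fun u => (if m u is k.+1 then row_form u ^+ k * (row_form u - t *: 'X_u) else
  1))).
  case: (m v) => [|k] /=; first by rewrite expr0 scale1r; ring.
  rewrite scale0r exprS; ring.
by move=> u neq; rewrite mnmDE mnm1E eq_sym (negbTE neq) addn0.
Qed.

Lemma row_prod0 : row_prod 0%MM = 1.
Proof. by rewrite /row_prod big1 // => v _; rewrite mnm0E. Qed.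

Lemma ymonS m v : ymon (m + U_(v))%MM = y v * ymon m.
Proof.
rewrite /ymon (bigD1 v) //= [in RHS](bigD1 v) //= mulrA mnmDE mnm1E eqxx addn1 exprS.
congr (_ * _); apply: eq_bigr => u neq.
by rewrite mnmDE mnm1E eq_sym (negbTE neq) addn0.
Qed.

Lemma ymon0 : ymon 0%MM = 1.
Proof. by rewrite /ymon big1 // => v _; rewrite mnm0E expr0. Qed.

Lemma aboveS b m v : (b <= v)%N -> above b (m + U_(v))%MM = above b m.
Proof.
move=> le; apply: eq_forallb => u; rewrite mnmDE mnm1E.
by case: (eqVneq v u) => [<-|_]; rewrite ?addn0 // ltnNge le.
Qed.

Lemma above_succ a m : above a.+1 m = (m a == 0%N) && above a m.
Proof.
apply/forallP/andP => [H|[ma /forallP H] u].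
  split; first by have := H a; rewrite ltnSn.
  by apply/forallP => u; apply/implyP => lt; have := H u; rewrite ltnS (ltnW lt).
apply/implyP; rewrite ltnS leq_eqVlt => /predU1P[/val_inj -> //|]; apply/implyP/H.
Qed.

Lemma above0 b : above b 0%MM.
Proof. by apply/forallP => v; rewrite mnm0E eqxx implybT. Qed.

(** The diagonal coefficients of MacMahon's master theorem, in total degree [n] and for contents
    with letters from [b] on only. *)
Definition diag_sum (b n : nat) : R :=
  sum_mdeg n (fun m => (above b m)%:R * (ymon m * (row_prod m)@_m)).

(* Reading the blocks as stacks of exits, these configurations are walks from [v]
   to [a] that use up every exit of [a], together with a balanced remainder. *)
Definition walk_sum a v n : R :=
  sum_mdeg n (fun m => (above a m)%:R * (ymon m * ('X_v * row_prod m)@_(m + U_(a)))).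

Lemma mcoeffXU_M (p : {mpoly R[r]}) v m : ('X_v * p)@_(m + U_(v)) = p@_m.
Proof. by rewrite mulrC addmC mcoeffMX. Qed.

Lemma mcoeffXU_M0 (p : {mpoly R[r]}) v m : m v = 0%N -> ('X_v * p)@_m = 0.
Proof.
move=> mv; rewrite mcoeffM big1 // => -[k1 k2] /= /eqP E.
rewrite mcoeffX; case: eqP => [Ek|_]; last by rewrite mul0r.
by have := congr1 (fun m1 : 'X_{1..r} => m1 v) E; rewrite mnmDE -Ek mnm1E eqxx mv.
Qed.

Lemma walk_diag a n : walk_sum a a n = diag_sum a n.
Proof. by apply: eq_sum_mdeg => m _; rewrite mcoeffXU_M. Qed.

Lemma diag_sum0 b : diag_sum b 0 = 1.
Proof. by rewrite /diag_sum sum_mdeg0 above0 ymon0 row_prod0 !mul1r mcoeff1 eqxx. Qed.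

Lemma walk_sum0 a v : (a < v)%N -> walk_sum a v 0 = 0.
Proof.
move=> lt; rewrite /walk_sum sum_mdeg0 mcoeffXU_M0 ?mulr0 //.
by rewrite mnmDE mnm0E mnm1E -val_eqE /= ltn_eqF.
Qed.

(* Pop one letter [u] off the block of [v] and continue from [u]. *)
Lemma walk_sum_peel a v n : (a <= v)%N ->
  sum_mdeg n (fun m => (above a (m + U_(v))%MM)%:R * (ymon (m + U_(v))%MM *
     ('X_v * row_prod (m + U_(v)))@_(m + U_(v) + U_(a)))) =
  y v * (\sum_(u < r | (a <= u)%N) adj t v u * walk_sum a u n
         - t * sum_mdeg n (fun m => (m v == 0%N)%:R * ((above a m)%:R * (ymon m * ('X_v *
           row_prod m)@_(m + U_(a)))))).
Proof.
move=> le_av.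
rewrite (eq_bigr (fun u : 'I_r => sum_mdeg n (fun m => adj t v u * ((above a m)%:R * (ymon m *
  ('X_u * row_prod m)@_(m + U_(a))))))); last first.
  by move=> u _; rewrite sum_mdegZ.
rewrite [X in X - _](_ : _ = sum_mdeg n (fun m => \sum_(u < r | (a <= u)%N) adj t v u * ((above
  a m)%:R * (ymon m * ('X_u * row_prod m)@_(m + U_(a)))))); last first.
  by rewrite /sum_mdeg exchange_big.
rewrite -mulrN -mulN1r mulrA -!sum_mdegZ -sum_mdegD -sum_mdegZ; apply: eq_sum_mdeg => m _.
rewrite aboveS // ymonS row_prodS.
rewrite (_ : (m + U_(v) + U_(a) = m + U_(a) + U_(v))%MM);
  last by rewrite -!addmA [(U_(v) + _)%MM]addmC.
rewrite mcoeffXU_M mulrBr mcoeffB.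
case: (boolP (above a m)) => ab; rewrite ?mul0r ?mulr0; last first.
  by rewrite big1 ?addr0 ?mulr0 // => u _; rewrite mul0r mulr0.
have -> : (row_prod m * row_form v)@_(m + U_(a)) =
    \sum_(u < r | (a <= u)%N) adj t v u * ('X_u * row_prod m)@_(m + U_(a)).
  rewrite mulr_sumr raddf_sum /= [RHS]big_mkcond; apply: eq_bigr => u _.
  rewrite -scalerAr mcoeffZ [row_prod m * _]mulrC; case: leqP => // ltu.
  rewrite mcoeffXU_M0 ?mulr0 // mnmDE mnm1E -val_eqE /= gtn_eqF // addn0.
  by move/forallP: ab => /(_ u)/implyP/(_ ltu)/eqP.
rewrite [in RHS](eq_bigr (fun u : 'I_r => ymon m * (adj t v u * ('X_u * row_prod m)@_(m +
  U_(a))))); last first.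
  by move=> u _; rewrite mul1r; ring.
rewrite -mulr_sumr mul1r -!scalerAr !mcoeffZ [row_prod m * 'X_v]mulrC mulr1n; ring.
Qed.

(** As [v] is not [a], the factor ['X_v] kills every coefficient at a content without [v]; this
    removes both the first part of [sum_mdegS] and the correction in [walk_sum_peel]. *)
Lemma walk_sumS a v n : (a < v)%N ->
  walk_sum a v n.+1 = y v * \sum_(u < r | (a <= u)%N) adj t v u * walk_sum a u n.
Proof.
move=> lt; rewrite /walk_sum (sum_mdegS _ v) walk_sum_peel ?(ltnW lt) //.
rewrite [X in _ - t * X](_ : _ = 0) ?mulr0 ?subr0; last first.
  rewrite /sum_mdeg big1 // => m _; case: eqP => mv; rewrite ?mul0r //.
  by rewrite mcoeffXU_M0 ?mulr0 // mnmDE mnm1E -val_eqE /= ltn_eqF // mv.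
rewrite [X in X + _](_ : _ = 0) ?add0r //.
rewrite /sum_mdeg big1 // => m _; case: eqP => mv; rewrite ?mul0r //.
by rewrite mcoeffXU_M0 ?mulr0 // mnmDE mnm1E -val_eqE /= ltn_eqF // mv.
Qed.

(** The contents without [a] give the first summand. In the others an exit of [a] is popped; the
    correction arises when it was the only one. *)
Lemma diag_sumS a n :
  diag_sum a n.+1 = diag_sum a.+1 n.+1 +
    y a * (\sum_(u < r | (a <= u)%N) adj t a u * walk_sum a u n - t * diag_sum a.+1 n).
Proof.
rewrite -walk_diag /walk_sum (sum_mdegS _ a) walk_sum_peel //.
have E k : sum_mdeg k (fun m => (m a == 0%N)%:R * ((above a m)%:R * (ymon m * ('X_a * row_prod
  m)@_(m + U_(a))))) = diag_sum a.+1 k.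
  apply: eq_sum_mdeg => m _; rewrite above_succ mcoeffXU_M.
  by case: eqP => _; rewrite ?mul1r ?mul0r.
by rewrite !E.
Qed.

Lemma diag_sum_word b n : (b <= r)%N -> diag_sum b n = word_sum t y r b n.
Proof.
move Ed : (r - b)%N => d; elim: d b n Ed => [|d IH] b n Ed le_br.
  have -> : b = r by lia.
  rewrite word_sum_geq //; case: n => [|n]; first exact: diag_sum0.
  rewrite /diag_sum /sum_mdeg big1 // => m /eqP Em.
  rewrite (_ : above r m = false) ?mul0r //; apply/negP => /forallP H.
  have : mdeg m == 0%N.
    rewrite mdeg_eq0; apply/eqP/mnmP => v; rewrite mnm0E; apply/eqP.
    by have := H v; rewrite ltn_ord.
  by rewrite Em.
have lt_br : (b < r)%N by lia.
pose a := Ordinal lt_br.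
(* [walk_sum] on natural numbers, with value 0 outside the alphabet. By [F0] and [FS] it obeys the
   linear recursion of [word_from], so [diag_sum b] satisfies [word_sumS]. *)
pose F k (v : nat) := oapp (fun u => walk_sum a u k) 0 (insub v).
have FE k (u : 'I_r) : F k u = walk_sum a u k by rewrite /F valK.
have split_a k (c : nat) : \sum_(u < r | (a <= u)%N) adj t c u * walk_sum a u k =
    adj t c a * diag_sum a k + \sum_(u < r | (a < u)%N) adj t c u * F k u.
  rewrite (eq_bigr (fun u : 'I_r => adj t c u * F k u)) => [|u _]; last by rewrite FE.
  by rewrite (@big_letters1 _ r b (fun u : nat => adj t c u * F k u)) // -[b]/(val a) FE
    walk_diag.
have F0 (v : nat) : (b < v < r)%N -> F 0%N v = 0.
  by case/andP=> ltbv ltvr; rewrite /F (insubT (fun i : nat => i < r)%N ltvr) /= walk_sum0.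
have FS k (v : nat) : (b < v < r)%N -> F k.+1 v =
    y v * (diag_sum b k + \sum_(u < r | (b < u)%N) adj t v u * F k u).
  case/andP=> ltbv ltvr; rewrite -[v]/(val (Ordinal ltvr)) FE walk_sumS // split_a.
  by rewrite /adj (ltnW ltbv) leqNgt ltbv mulr0 addr0 mul1r.
apply: word_sum_unique => // [|k]; first exact: diag_sum0.
rewrite -(sum_linear_word_from F0 FS) [diag_sum b k.+1](diag_sumS a) !(IH b.+1); try lia.
rewrite split_a /= /adj leqnn.
congr (_ + _ * (_ - _)).
rewrite (eq_bigr (fun u : 'I_r => t * F k u)) => [|u ltu].
  by rewrite -mulr_sumr /=; ring.
by rewrite leqNgt ltu (ltnW ltu) add0r mulr1.
Qed.
End Master.

(** * Contents of words *)

Definition content r n (f : 'I_n -> 'I_r) : 'X_{1..r} :=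
  [multinom #|[set k | f k == v]| | v < r].

Lemma content_sum r n (f : 'I_n -> 'I_r) : content f = (\sum_k U_(f k))%MM.
Proof.
apply/mnmP => v; rewrite mnmE mnm_sumE -sum1_card big_mkcond; apply: eq_bigr => k _.
by rewrite inE mnm1E; case: eqP.
Qed.

Lemma mdeg_content r n (f : 'I_n -> 'I_r) : mdeg (content f) = n.
Proof.
rewrite content_sum mdeg_sum (eq_bigr (fun=> 1%N)) => [|k _]; last exact: mdeg1.
by rewrite sum1_card card_ord.
Qed.

Lemma prod_content (R : comNzRingType) r n (f : 'I_n -> 'I_r) (y : nat -> R) :
  ymon y (content f) = \prod_k y (f k).
Proof.
rewrite /ymon [RHS](partition_big f xpredT) //=; apply: eq_bigr => v _.
rewrite mnmE (eq_bigr (fun=> y v)) => [|k /eqP -> //].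
by rewrite prodr_const; congr (_ ^+ _); apply: eq_card => k; rewrite !inE.
Qed.

Lemma mpolyX_sum (R : comNzRingType) r (I : finType) (f : I -> 'X_{1..r}) :
  'X_[\sum_k f k] = \prod_k 'X_[f k] :> {mpoly R[r]}.
Proof. by apply: (big_morph (fun m => 'X_[m] : {mpoly R[r]})); [exact: mpolyXD|exact: mpolyX0].
  Qed.

Lemma same_contentE r n (s : {ffun 'I_n -> 'I_r}) (w : {ffun 'I_n -> 'I_r * bool}) :
  same_content s w = (content (fun k => (w k).1) == content s).
Proof.
apply/forallP/eqP => [H|H v]; first by apply/mnmP => v; rewrite !mnmE; apply/eqP.
by move/mnmP/(_ v): H; rewrite !mnmE => ->.
Qed.

(** [sorted_label] recovers a weakly decreasing word from any marked word [w] of its content; the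
    marks in [w] may be chosen at will. *)
Lemma weakly_decreasing_content_inj r n (s s' : {ffun 'I_n -> 'I_r}) :
  weakly_decreasing s -> weakly_decreasing s' -> content s = content s' -> s = s'.
Proof.
move=> dec dec' E; pose w : {ffun 'I_n -> 'I_r * bool} := [ffun k => (s k, true)].
have Ew : content (fun k => (w k).1) = content s.
  by apply/mnmP => v; rewrite !mnmE; apply: eq_card => k; rewrite !inE ffunE.
apply/ffunP => i; rewrite -(sorted_label (w := w) dec) ?same_contentE ?Ew //.
by rewrite (sorted_label (w := w) dec') // same_contentE Ew E.
Qed.

Lemma weakly_decreasing_content_ex r n (m : 'X_{1..r}) : mdeg m = n ->
  exists2 s : {ffun 'I_n -> 'I_r}, weakly_decreasing s & content s = m.
Proof.
elim: n m => [|n IH] m Em.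
  have f : 'I_0 -> 'I_r by case.
  exists (finfun f); first by apply/weakly_decreasingP => -[].
  by rewrite content_sum big_ord0; apply/esym/eqP; rewrite -mdeg_eq0 Em.
have [v0 v0P] : exists v : 'I_r, (0 < m v)%N.
  apply/existsP; rewrite -[X in is_true X]negbK negb_exists; apply/negP => /forallP H.
  suff m0 : m = 0%MM by rewrite m0 mdeg0 in Em.
  by apply/mnmP => v; rewrite mnm0E; apply/eqP; rewrite -leqn0 leqNgt.
(* The smallest letter [v] of the content is placed last, after a weakly decreasing word for the
   rest. *)
case: (@arg_minnP _ v0 (fun v => 0 < m v)%N (fun v => v : nat) v0P) => v vP minv.
have Um : (U_(v) <= m)%MM by apply/mnm_lepP => i; rewrite mnm1E; case: (eqVneq v i) => [<-|].
have [|s dec Es] := IH (m - U_(v))%MM.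
  by move: Em; rewrite -{1}(submK Um) mdegD mdeg1 addn1 => -[].
have lastE : ffun_rcons (s, v) ord_max = v by rewrite ffunE unlift_none.
have initE (j : 'I_n) : ffun_rcons (s, v) (lift ord_max j) = s j by rewrite ffunE liftK.
have les j : (v <= s j)%N.
  apply: minv; move/mnmP/(_ (s j)): Es; rewrite mnmE mnmBE.
  have : (0 < #|[set k | s k == s j]|)%N by apply/card_gt0P; exists j; rewrite inE.
  by move=> + E; rewrite E subn_gt0; apply: leq_ltn_trans.
exists (ffun_rcons (s, v)).
  apply/weakly_decreasingP => i j; case: (unliftP ord_max i) => [i'|] ->;
    case: (unliftP ord_max j) => [j'|] ->.
  - by rewrite !initE !lift_max; apply: (weakly_decreasingP _ dec).
  - by rewrite lastE initE => _; apply: les.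
  - by rewrite lift_max /= => le; have := leq_ltn_trans le (ltn_ord j'); rewrite ltnn.
  - by [].
rewrite content_sum big_ord_recr /= lastE -(submK Um) -Es content_sum; congr (_ + _)%MM.
apply: eq_bigr => j _; congr U_(_)%MM; rewrite -initE; congr (ffun_rcons _ _).
by apply: val_inj; exact: esym (lift_max j).
Qed.

Lemma sum_weakly_decreasing (R : comNzRingType) r n (F : 'X_{1..r} -> R) :
  \sum_(s : {ffun 'I_n -> 'I_r} | weakly_decreasing s) F (content s) = sum_mdeg n F.
Proof.
have lt (s : {ffun 'I_n -> 'I_r}) : (mdeg (content s) < n.+1)%N by rewrite mdeg_content.
rewrite (partition_big (fun s => BMultinom (lt s)) (fun m => mdeg m == n)) /=; last first.
  by move=> s _; rewrite mdeg_content.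
apply: eq_bigr => m /eqP /weakly_decreasing_content_ex [s0 dec0 E0].
rewrite (big_pred1 s0) ?E0 // => s /=; rewrite bmeqP /= -E0.
apply/andP/eqP => [[dec /eqP E]|->]; last by rewrite dec0.
exact: weakly_decreasing_content_inj.
Qed.

Section Coefficients.
Variables (R : comNzRingType) (t : R) (r n : nat) (s : {ffun 'I_n -> 'I_r}).

Definition letter_form k : {mpoly R[r]} := \sum_(a | letter_ok s k a) t ^+ a.2 *: 'X_a.1.

Lemma letter_formE k : letter_form k =
  if first_in_block s k then row_form t (s k) - t *: 'X_(s k) else row_form t (s k).
Proof.
rewrite /letter_form big_mkcond -(pair_bigA _ (fun u b => if letter_ok s k (u, b) then t ^+ b
  *: 'X_u else 0)) /=.
have E (fst : bool) : (if fst then row_form t (s k) - t *: 'X_(s k) else row_form t (s k)) =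
    \sum_(u < r) (adj t (s k) u - (fst && (u == s k))%:R * t) *: 'X_u :> {mpoly R[r]}.
  case: fst; last by apply: eq_bigr => u _; rewrite mul0r subr0.
  rewrite /row_form (bigD1 (s k)) //= [in RHS](bigD1 (s k)) //= eqxx mul1r scalerBl addrAC.
  by congr (_ + _); apply: eq_bigr => u /negbTE ->; rewrite mul0r subr0.
rewrite E; apply: eq_bigr => u _; rewrite big_bool /letter_ok /= expr1 expr0 scale1r /adj.
case: (ltngtP (s k) u) => [lt|lt|/val_inj ->] /=.
- rewrite (_ : u == s k = false) ?andbF /=; last by apply/negP => /eqP Eu; rewrite Eu ltnn in lt.
  by rewrite mul0r mulr1 addr0 add0r subr0.
- rewrite (_ : u == s k = false) ?andbF /=; last by apply/negP => /eqP Eu; rewrite Eu ltnn in lt.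
  by rewrite mul0r mulr0 addr0 add0r subr0 scale1r.
rewrite eqxx andbT; case: first_in_block => /=.
  by rewrite add0r mulr1 mul1r addrK scale1r.
by rewrite mul0r subr0 mulr1 scalerDl scale1r addrC.
Qed.

(** Positions are grouped by their letter; each nonempty block has exactly one first position, which
    gives the special factor of [row_prod]. *)
Lemma prod_letter_form : weakly_decreasing s ->
  \prod_k letter_form k = row_prod t (content s).
Proof.
move=> /weakly_decreasingP dec; rewrite /row_prod (partition_big s xpredT) //=.
apply: eq_bigr => v _; rewrite mnmE.
have [k0 k0P|none] := pickP (fun k => s k == v); last first.
  rewrite big_pred0 // (_ : [set k | s k == v] = set0) ?cards0 //.
  by apply/setP => k; rewrite !inE none.
case: (@arg_minnP _ k0 (fun k => s k == v) (fun k => k : nat) k0P) => f fP minf.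
have firstE k : s k == v -> first_in_block s k = (k == f).
  move=> kP; apply/forallP/eqP => [H|-> j].
    apply/eqP; apply: contraT => neq; have ltfk : (f < k)%N by rewrite ltn_neqAle eq_sym neq minf.
    by have := H f; rewrite ltfk (eqP kP) fP.
  by apply/implyP => ltj; apply: contraL ltj; rewrite (eqP fP) -leqNgt => /minf.
rewrite (bigD1 f) //= letter_formE firstE // eqxx (eqP fP) mulrC.
rewrite (eq_bigr (fun=> row_form t v)) => [|k /andP[kP neq]]; last first.
  by rewrite letter_formE firstE // (negbTE neq) (eqP kP).
rewrite prodr_const (cardsD1 f) inE fP add1n; congr (_ ^+ _ * _).
by apply: eq_card => k; rewrite !inE andbC.
Qed.

(** Expanding the product chooses an allowed marked letter at every position; the coefficient keeps
    the choices with the content of [s], which standardization turns into permutations. *)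
Lemma coef_row_prod : weakly_decreasing s ->
  (row_prod t (content s))@_(content s) = \sum_(p | compatible s p) t ^+ exc p.
Proof.
move=> dec; rewrite sum_compatible // -prod_letter_form // /letter_form.
rewrite bigA_distr_big_dep raddf_sum /=.
rewrite [RHS](eq_bigl (fun w => (w \in family (letter_ok s)) && same_content s w)); last first.
  move=> w; rewrite andbC; congr (_ && _).
rewrite [RHS]big_mkcondr; apply: eq_bigr => w _.
rewrite scaler_prod -mpolyX_sum -content_sum mcoeffZ mcoeffX same_contentE.
by case: eqP => _; rewrite ?mulr1 ?mulr0.
Qed.
End Coefficients.

Lemma sum_exc_word_sum (R : comNzRingType) (t q : R) n r :
  \sum_(s : {ffun 'I_n -> 'I_r} | weakly_decreasing s)
      (\prod_i q ^+ s i) * (\sum_(p | compatible s p) t ^+ exc p) =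
  word_sum t (fun v => q ^+ v) r 0 n.
Proof.
rewrite -diag_sum_word // /diag_sum -sum_weakly_decreasing; apply: eq_bigr => s dec.
rewrite prod_content coef_row_prod // (_ : above 0 _) ?mul1r //.
by apply/forallP.
Qed.

(** * Specialization to integer polynomials *)

Local Notation qq := (('X : {poly int})%:P : {poly {poly int}}).

Lemma polyC_Xn n : ('X^n : {poly int})%:P = qq ^+ n.
Proof. by rewrite rmorphXn. Qed.

Lemma qfact_qpoch n : qfact qq n = (qpoch n)%:P.
Proof.
rewrite /qpoch rmorph_prod; apply: eq_bigr => i _.
by rewrite rmorphB rmorph1 rmorphXn.
Qed.

Lemma qpoch_neq0 n : qpoch n != 0.
Proof.
rewrite -lead_coef_eq0; have := lead_coef_qpoch n.
by apply: contraL => /eqP ->; rewrite unitr0.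
Qed.

Lemma qfact_lreg n : GRing.lreg (qfact qq n).
Proof. by apply: mulfI; rewrite qfact_qpoch polyC_eq0 qpoch_neq0. Qed.

Lemma gbin_qbinom n m : (m <= n)%N -> gbin qq n m = (qbinom n m)%:P.
Proof.
move=> le_mn; apply: (@qfact_lreg m); apply: (@qfact_lreg (n - m)).
have := gbin_fact qq m (n - m); rewrite subnKC // => E.
transitivity (qfact qq n); first by rewrite -E; ring.
by rewrite !qfact_qpoch -!rmorphM -(qbinomE le_mn); congr _%:P; ring.
Qed.

Lemma eqmodr_all (x y : {poly {poly int}}) : (forall r, eqmodr (qq ^+ r) x y) -> x = y.
Proof.
move=> H; apply/polyP => i; apply/eqP; rewrite -subr_eq0; apply: contraT => nz.
(* A nonzero polynomial in q cannot be a multiple of q to the power of its own size. *)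
have [g Eg] := H (size (x`_i - y`_i)).
have : x`_i - y`_i = 'X^(size (x`_i - y`_i)) * g`_i.
  by rewrite {1}Eg coefD -polyC_Xn coefCM addrC addKr.
move=> E; have gnz : g`_i != 0 by apply: contra nz => /eqP g0; rewrite E g0 mulr0.
have := congr1 (fun p : {poly int} => size p) E.
rewrite size_monicM ?monicXn // size_polyXn /= => Es.
by move/esym/eqP: Es; rewrite -[X in _ == X]addn0 eqn_add2l size_poly_eq0 (negbTE gnz).
Qed.

Lemma A_qEul n : A n = qEul 'X qq n.
Proof.
have -> : A n = \sum_(p : 'S_n) qq ^+ (maj p - exc p) * 'X ^+ exc p.
  by apply: eq_bigr => p _; rewrite -mul_polyC polyC_Xn.
apply: eqmodr_all => r.
(* [word_sum_qEul] modulo q^r needs [r + 1] letters; the congruence modulo q^(r+1) obtained here is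
   then weakened. *)
have := sum_maj_exc 'X qq n r.+1; rewrite sum_exc_word_sum => -[g Eg].
apply: eqmodr_trans (word_sum_qEul 'X qq r n).
by exists (- (qq * g)); rewrite Eg exprS; ring.
Qed.

Theorem theorem1p1 (n : nat) (n_ge1 : (1 <= n)%N) :
  tA n = \sum_(p in PRW n.+1) 'X^(ai p) *: 'X^(des p).
Proof.
have -> : \sum_(p in PRW n.+1) 'X^(ai p) *: 'X^(des p) = qbinEul 'X qq n.
  rewrite -(@sum_perm_weight_prw _ 'X qq qfact_lreg _ [set: 'I_n.+1] ord0 n) ?cardsT ?card_ord
    ?inE //.
  rewrite -big_perm_seq big_mkcond; apply: eq_bigr => p _.
  rewrite -prw_perm_seq /perm_weight des_perm_seq ai_perm_seq.
  by case: sprw; rewrite ?mul1r ?mul0r // -mul_polyC polyC_Xn mulrC.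
rewrite /tA /qbinEul; congr (1 + 'X * _).
rewrite [LHS]big_nat_cond [RHS]big_nat_cond; apply: eq_bigr => m /andP[/andP[_ le] _].
by rewrite -mul_polyC A_qEul gbin_qbinom.
Qed.
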